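(* Define $\mathfrak M\colon\mathbf R_{\ge0}\to\mathbf Q_{>0}$ by $$\mathfrak{M}(t)= \frac{p^{2\lceil t\rceil+3}}{p-1}\prod_{k=0}^{\lceil t\rceil}\left(k+\frac{p+1}{p}\right)^2-(p-1)\sum_{k=0}^{\lceil t\rceil}(k+1)p^k\prod_{l=0}^{k-1}\left(l+\frac{p+1}{p}\right).$$ For every $f\in\mathbf E^{\mathrm{np},\circ,+}_{\mathfrak F,\mathbf Q_p}$ with $v^\flat(f)\ge\mathfrak M(0)$ one has $$v_{\mathrm{mono}}(f)\le v^\flat(f)<\mathfrak M\big(v_{\mathrm{mono}}(f)\big),$$ and $\mathfrak M(t)=O\big(p^{2t}\,\Gamma(t+C)^2\big)$ as $t\to\infty$, where $C=3+\frac1p$ and $\Gamma(\cdot)$ is the Gamma function.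
   Context: Let $p\ge3$ be prime, $\mathbf C_p^\flat$ the tilt of $\mathbf C_p$ with valuation $v^\flat(x)=v_p(x^\sharp)$, $v_p(p)=1$. Let $u=(p,p^{1/p},p^{1/p^2},\dots)$ and $\varepsilon=(1,\zeta_p,\zeta_{p^2},\dots)$ in $\mathbf C_p^\flat$, $\eta=\varepsilon-1$; so $v^\flat(u)=1$ and $v^\flat(\eta)=p/(p-1)$. Let $\mathbf E^{\mathrm{np},\circ,+}_{\mathfrak F,\mathbf Q_p}=\{\sum_{i,j\ge0}f_{ij}u^i\eta^j:\ \sum f_{ij}X^iY^j\in\mathbf F_p[[X,Y]]\}\subset\mathbf C_p^\flat$ (the series converging as limits of partial sums $\sum_{i,j\le n}$); the map $\mathbf F_p[[X,Y]]\to\mathbf C_p^\flat$, $\sum f_{ij}X^iY^j\mapsto\sum f_{ij}u^i\eta^j$ is injective, so the coefficients $f_{ij}$ of an element are well defined. The monomial valuation is $v_{\mathrm{mono}}\big(\sum f_{ij}u^i\eta^j\big)=\min_{f_{ij}\ne0}\big(i\,v^\flat(u)+j\,v^\flat(\eta)\big)$. *)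

(* Defs.v *)
From HB Require Import structures.
From mathcomp Require Import all_boot all_order all_algebra.
From mathcomp Require Import all_classical all_reals all_analysis.
From mathcomp Require Import ring lra zify.

Set Implicit Arguments.
Unset Strict Implicit.
Unset Printing Implicit Defensive.

Import Order.TTheory GRing.Theory Num.Theory.
Import numFieldNormedType.Exports.

Local Open Scope classical_set_scope.
Local Open Scope ring_scope.

Section valued.
Variables (R : realType) (V : zmodType) (v : V -> \bar R).

Definition vcvg (s : nat -> V) (l : V) :=
  forall A : R, exists N : nat, forall n, (N <= n)%N -> (A%:E <= v (s n - l))%E.

Definition vcauchy (s : nat -> V) :=
  forall A : R, exists N : nat, forall m n, (N <= m)%N -> (N <= n)%N ->
    (A%:E <= v (s m - s n))%E.

Definition vclosure (S : set V) : set V :=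
  [set x | forall A : R, exists2 y, S y & (A%:E <= v (x - y))%E].

Definition vlim (s : nat -> V) : V := xget 0 [set l | vcvg s l].

End valued.

Definition algebraic_elements (K : fieldType) (F : set K) : set K :=
  [set x | exists q : {poly K}, [/\ q != 0, forall i, F q`_i & root q x]].

(* [CpField R p] is the type of models of C_p, which is unique up to an
   isomorphism of valued fields.  In a model, Q_p is the closure of Q: the
   axioms force the valuation to be the p-adic one on Q, and a closed subset of
   a complete field is complete.  The algebraic closure of Q_p is the set of the
   elements of the field which are algebraic over Q_p, and the field itself is
   the completion of this algebraic closure. *)
Record CpField (R : realType) (p : nat) := MkCpField {
  Cp_sort :> fieldType;
  vp : Cp_sort -> \bar R;
  Cp_prime : prime p;
  vp_eqy : forall x, (vp x == +oo%E) = (x == 0);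
  vp_fin : forall x, x != 0 -> vp x \is a fin_num;
  vpM : forall x y, vp (x * y) = (vp x + vp y)%E;
  vpD : forall x y, (mine (vp x) (vp y) <= vp (x + y))%E;
  vp_p : vp p%:R = 1%E;
  Cp_complete : forall s, vcauchy vp s -> exists l, vcvg vp s l;
  Qp := vclosure vp (range (@ratr Cp_sort));
  Qpbar := algebraic_elements Qp;
  Qpbar_closed : forall q : {poly Cp_sort}, (1 < size q)%N ->
    (forall i, Qpbar q`_i) -> exists2 x, Qpbar x & root q x;
  Qpbar_dense : vclosure vp Qpbar = setT
}.

Local Lemma exprD_middle (K : comNzRingType) (b d : K) n : (0 < n)%N ->
  (b + d) ^+ n = b ^+ n + d ^+ n +
    \sum_(i < n.-1) (b ^+ (n - i.+1) * d ^+ i.+1) *+ 'C(n, i.+1).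
Proof.
case: n => // q _; rewrite exprDn big_ord_recr big_ord_recl /=.
by rewrite bin0 binn subn0 subnn !expr0 mulr1 mul1r !mulr1n addrAC.
Qed.

Section Tilt.
Variables (R : realType) (p : nat) (C : CpField R p).
Implicit Types (a b c d : C) (r β γ : R).

Record tilt := MkTilt {
  tseq :> nat -> C;
  tseqP : forall n, tseq n.+1 ^+ p = tseq n }.

Lemma tilt_eq (x y : tilt) : tseq x =1 tseq y -> x = y.
Proof.
case: x y => [x hx] [y hy] /= /funext e; subst y; congr MkTilt.
exact: Prop_irrelevance.
Qed.

HB.instance Definition _ := gen_eqMixin tilt.
HB.instance Definition _ := gen_choiceMixin tilt.

Definition sharp (x : tilt) : C := x 0%N.

Definition vflat (x : tilt) : \bar R := vp (sharp x).

(* The n-th component of a sum (or opposite) in the tilt, computed from the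
   componentwise sum (or opposite) s, is the limit of s_{n+k}^(p^k). *)
Definition tlim (s : nat -> C) (n : nat) : C :=
  vlim (@vp R p C) (fun k => s (n + k)%N ^+ (p ^ k)).

Local Definition ge a r := (r%:E <= vp a)%E.
Local Definition P : R := p%:R.
Local Definition pp := Cp_prime C.

Local Lemma p_gt0 : (0 < p)%N. Proof. exact: prime_gt0 pp. Qed.
Local Lemma P2 : 2 <= P. Proof. by rewrite /P ler_nat (prime_gt1 pp). Qed.
Local Lemma P0 : 0 < P. Proof. by apply: lt_le_trans P2. Qed.
Local Lemma Pn0 : P != 0. Proof. by rewrite gt_eqF// P0. Qed.
Local Lemma Pk0 k : 0 < P ^+ k. Proof. exact: exprn_gt0 P0. Qed.
Local Lemma Pkn0 k : P ^+ k != 0. Proof. by rewrite gt_eqF// Pk0. Qed.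
Local Lemma Pk1 k : 1 <= P ^+ k. Proof. by apply: exprn_ege1; move: P2; lra. Qed.

#[local] Hint Resolve p_gt0 P0 Pk0 : core.

Local Lemma ge0 r : ge 0 r.
Proof. by rewrite /ge (eqP (_ : vp (0 : C) == +oo%E)) ?leey// vp_eqy. Qed.

#[local] Hint Resolve ge0 : core.

Local Lemma geW a r r' : r' <= r -> ge a r -> ge a r'.
Proof. by move=> h; apply: le_trans; rewrite lee_fin. Qed.

Local Lemma geD a b r : ge a r -> ge b r -> ge (a + b) r.
Proof. by move=> ha hb; apply: le_trans (vpD a b); rewrite le_min; apply/andP. Qed.

Local Lemma geM a b r r' : ge a r -> ge b r' -> ge (a * b) (r + r').
Proof. by move=> ha hb; rewrite /ge vpM EFinD leeD. Qed.

Local Lemma v1 : vp (1 : C) = 0%E.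
Proof.
have /fineK <- := @vp_fin R p C 1 (oner_neq0 _).
have := vpM (1 : C) 1; rewrite mulr1.
have /fineK <- := @vp_fin R p C 1 (oner_neq0 _).
by rewrite -EFinD => -[] h; congr EFin; move: h; lra.
Qed.

Local Lemma ge1 : ge 1 0. Proof. by rewrite /ge v1. Qed.

#[local] Hint Resolve ge1 : core.

Local Lemma vN1 : vp (-1 : C) = 0%E.
Proof.
have n0 : (-1 : C) != 0 by rewrite oppr_eq0 oner_neq0.
have /fineK <- := vp_fin n0.
have := vpM (-1 : C) (-1); rewrite mulrNN mulr1 v1.
have /fineK <- := vp_fin n0.
by rewrite -EFinD => -[] h; congr EFin; move: h; lra.
Qed.

Local Lemma geN a r : ge a r -> ge (- a) r.
Proof. by move=> h; rewrite -mulN1r -[r]add0r; apply: geM => //; rewrite /ge vN1. Qed.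

Local Lemma geB a b r : ge a r -> ge b r -> ge (a - b) r.
Proof. by move=> ha hb; apply: geD => //; apply: geN. Qed.

Local Lemma geMn a n r : ge a r -> ge (a *+ n) r.
Proof.
by move=> h; elim: n => [|n ih]; rewrite ?mulr0n// mulrS; apply: geD.
Qed.

Local Lemma geX a n r : ge a r -> ge (a ^+ n) (n%:R * r).
Proof.
move=> h; elim: n => [|n ih]; first by rewrite expr0 mul0r.
by rewrite exprS -natr1 mulrDl mul1r addrC; apply: geM.
Qed.

Local Lemma gep : ge p%:R 1. Proof. by rewrite /ge vp_p. Qed.

Local Lemma ge_sum (I : Type) (l : seq I) (Q : pred I) (F : I -> C) r :
  (forall i, Q i -> ge (F i) r) -> ge (\sum_(i <- l | Q i) F i) r.
Proof. by move=> h; elim/big_ind : _ => // x y; apply: geD. Qed.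

Local Lemma nat_gt r : exists k : nat, r < k%:R.
Proof.
exists (Num.bound `|r|).
exact: le_lt_trans (ler_norm _) (archi_boundP (normr_ge0 _)).
Qed.

Local Lemma ge_inf a r : (forall k : nat, ge a (k%:R - r)) -> a = 0.
Proof.
move=> h; apply/eqP; apply: contraT => /vp_fin /fineK e.
have [k hk] : exists k : nat, fine (vp a) + r < k%:R. by exact: nat_gt.
move: (h k); rewrite /ge -e lee_fin; move: hk; lra.
Qed.

Local Lemma frob b d β γ : 0 <= γ -> ge b (- β) -> ge d (γ - β) ->
  ge ((b + d) ^+ p - b ^+ p - d ^+ p) (1 + γ - P * β).
Proof.
move=> g0 hb hd; rewrite (exprD_middle _ _ p_gt0).
rewrite [X in ge X](_ : _ = \sum_(i < p.-1) (b ^+ (p - i.+1) * d ^+ i.+1) *+ 'C(p, i.+1)); last by ring.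
apply: ge_sum => i _.
have ip : (i.+1 < p)%N by have := ltn_ord i; lia.
have /dvdnP[m ->] : (p %| 'C(p, i.+1))%N by apply: prime_dvd_bin; [exact: pp|].
rewrite mulnC mulrnA; apply: geMn; rewrite -mulr_natl.
rewrite -addrA; apply: geM; first exact: gep.
have h1 := geX (p - i.+1) hb.
have h2 := geX i.+1 hd.
apply: geW (geM h1 h2); rewrite natrB 1?ltnW// /P.
have : 0 <= i%:R * γ by rewrite mulr_ge0.
rewrite -[i.+1%:R]natr1; lra.
Qed.

Local Lemma pw1 a b β γ : 1 <= γ -> ge a (- β) -> ge b (- β) -> ge (a - b) (γ - β) ->
  ge (a ^+ p - b ^+ p) (γ + 1 - P * β).
Proof.
move=> g1 ha hb hd; have g0 : 0 <= γ by lra.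
have := frob g0 hb hd; rewrite [b + _]addrC subrK => h.
rewrite -[_ - _](subrK ((a - b) ^+ p)); apply: geD.
  by apply: geW h; lra.
apply: geW (geX p hd); rewrite -/P.
have : 2 * γ <= P * γ by apply: ler_wpM2r => //; exact: P2.
lra.
Qed.

Local Lemma pwk a b β γ k : 1 <= γ -> ge a (- β) -> ge b (- β) -> ge (a - b) (γ - β) ->
  ge (a ^+ (p ^ k) - b ^+ (p ^ k)) (γ + k%:R - P ^+ k * β).
Proof.
move=> g1 ha hb hd; elim: k => [|k ih]; first by rewrite expn0 expr0 mul1r addr0.
rewrite expnSr !exprM exprS -natr1 addrA -mulrA.
have gX c : ge c (- β) -> ge (c ^+ (p ^ k)) (- (P ^+ k * β)).
  by move=> hc; apply: geW (geX (p ^ k) hc); rewrite natrX -/P mulrN.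
by apply: pw1; [have := ler0n R k; lra | exact: gX..|].
Qed.

Local Definition bd (s : nat -> C) B := forall m, ge (s m) (- (B / P ^+ m)).
Local Definition near_ (x s : nat -> C) B := forall m, ge (x m - s m) (1 - B / P ^+ m).
Local Definition near x s := exists2 B, 0 <= B & near_ x s B.
Local Definition ac_ s B := bd s B /\ forall m, ge (s m.+1 ^+ p - s m) (1 - B / P ^+ m).
Local Definition ac s := exists2 B, 0 <= B & ac_ s B.

Local Lemma divle B B' m : B <= B' -> B / P ^+ m <= B' / P ^+ m.
Proof. by move=> h; rewrite ler_pM2r// invr_gt0. Qed.
Local Lemma bdW s B B' : B <= B' -> bd s B -> bd s B'.
Proof. by move=> h hs m; apply: geW (hs m); have := divle m h; lra. Qed.
Local Lemma nearW x s B B' : B <= B' -> near_ x s B -> near_ x s B'.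
Proof. by move=> h hs m; apply: geW (hs m); have := divle m h; lra. Qed.

Local Lemma tilt_pow (x : tilt) n k : x n = x (n + k)%N ^+ (p ^ k).
Proof.
elim: k => [|k ih]; first by rewrite addn0.
by rewrite ih addnS -(tseqP x (n + k)) -exprM expnS.
Qed.

Local Lemma vpX a n r : vp a = r%:E -> vp (a ^+ n) = (n%:R * r)%:E.
Proof.
move=> h; elim: n => [|n ih]; first by rewrite expr0 mul0r v1.
by rewrite exprS vpM h ih -EFinD -natr1 mulrDl mul1r addrC.
Qed.

Local Lemma tilt_bd (x : tilt) : exists2 B, 0 <= B & bd x B.
Proof.
exists `|fine (vp (x 0%N))| => // m.
have [->|n0] := eqVneq (x m) 0; first exact: ge0.
have /fineK e := vp_fin n0; rewrite /ge -e lee_fin.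
rewrite (tilt_pow x 0 m) add0n (vpX _ (esym e)) /= natrX -/P.
have := ler_norm (- (P ^+ m * fine (vp (x m)))); rewrite normrN => h.
rewrite -mulNr ler_pdivrMr//; move: h; lra.
Qed.

Local Lemma cvg_uniq s l l' : vcvg (@vp R p C) s l -> vcvg (@vp R p C) s l' -> l = l'.
Proof.
move=> h h'; apply/eqP; rewrite -subr_eq0; apply/eqP/(@ge_inf _ 0) => k.
have [N hN] := h (k%:R - 0); have [N' hN'] := h' (k%:R - 0).
have -> : l - l' = (s (maxn N N') - l') - (s (maxn N N') - l) by ring.
by apply: geB; [apply: hN'; rewrite leq_maxr|apply: hN; rewrite leq_maxl].
Qed.

Local Lemma tlim_cvg s B n : ac_ s B ->
  vcvg (@vp R p C) (fun k => s (n + k)%N ^+ (p ^ k)) (tlim s n) /\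
  forall k, ge (tlim s n - s (n + k)%N ^+ (p ^ k)) (1 + k%:R - B / P ^+ n).
Proof.
move=> [hb hc]; set t := fun k => _.
have st k : ge (t k.+1 - t k) (1 + k%:R - B / P ^+ n).
  rewrite /t addnS expnS exprM.
  have -> : B / P ^+ n = P ^+ k * (B / P ^+ (n + k)).
    by rewrite exprD; field; rewrite !Pkn0.
  apply: pwk => //.
  apply: geW (geX p (hb (n + k).+1)); rewrite -/P exprS.
  by rewrite le_eqVlt; apply/orP; left; apply/eqP; field; rewrite Pn0 Pkn0.
have sj k j : ge (t (k + j)%N - t k) (1 + k%:R - B / P ^+ n).
  elim: j => [|j ih]; first by rewrite addn0 subrr.
  have -> : t (k + j.+1)%N - t k = (t (k + j).+1 - t (k + j)%N) + (t (k + j)%N - t k).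
    by rewrite addnS; ring.
  apply: geD => //; apply: geW (st _).
  by rewrite natrD; have := ler0n R j; lra.
have [l hl] : exists l, vcvg (@vp R p C) t l.
  apply: Cp_complete => A.
  have [k hk] : exists k : nat, A + B / P ^+ n < k%:R. by exact: nat_gt.
  exists k => i j /subnKC <- /subnKC <-.
  have -> : t (k + (i - k))%N - t (k + (j - k))%N = (t (k + (i - k))%N - t k) - (t (k + (j - k))%N - t k) by ring.
  by apply: geB; apply: geW (sj _ _); lra.
have hlim : vcvg (@vp R p C) t (tlim s n).
  by rewrite /tlim /vlim; case: xgetP => [y _ //|/(_ l)].
split=> // k; have [N hN] := hlim (1 + k%:R - B / P ^+ n).
have -> : tlim s n - s (n + k)%N ^+ (p ^ k) = (t (k + N)%N - t k) - (t (k + N)%N - tlim s n).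
  by rewrite /t; ring.
by apply: geB => //; apply: hN; rewrite leq_addl.
Qed.

Local Lemma tlimP s : ac s -> forall n, tlim s n.+1 ^+ p = tlim s n.
Proof.
move=> [B B0 hs] n; have [c0 _] := tlim_cvg n hs; apply: cvg_uniq c0 => A.
have [_ h1] := tlim_cvg n.+1 hs; have [hb hc] := hs.
have [k hk] : exists k : nat, A + B / P ^+ n < k%:R. by exact: nat_gt.
exists k.+1 => -[//|m]; rewrite ltnS => km.
rewrite addnS -addSn expnSr exprM.
have hl : ge (tlim s n.+1) (- (B / P ^+ n.+1)).
  rewrite -[tlim _ _](subrK (s n.+1)); apply: geD => //.
  by have := h1 0%N; rewrite addn0 expn0 expr1; apply: geW; lra.
have gX : ge (s (n.+1 + m)%N ^+ (p ^ m)) (- (B / P ^+ n.+1)).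
  apply: geW (geX (p ^ m) (hb _)); rewrite natrX -/P exprD.
  by rewrite le_eqVlt; apply/orP; left; apply/eqP; field; rewrite !Pkn0.
have g1 : 1 <= 1 + m%:R :> R by have := ler0n R m; lra.
have := pw1 g1 hl gX (h1 m) => /geN; rewrite opprB; apply: geW.
have -> : P * (B / P ^+ n.+1) = B / P ^+ n by rewrite exprS; field; rewrite Pn0 Pkn0.
have : k%:R <= m%:R :> R by rewrite ler_nat.
move: hk; lra.
Qed.

Local Lemma tlim_near s : ac s -> near (tlim s) s.
Proof.
move=> [B B0 hs]; exists B => // m; have [_ /(_ 0%N)] := tlim_cvg m hs.
by rewrite addn0 expn0 expr1 addr0.
Qed.

Local Lemma near_sym x s : near x s -> near s x.
Proof. by move=> [B B0 h]; exists B => // m; rewrite -opprB; apply: geN. Qed.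

Local Lemma near_trans x y z : near x y -> near y z -> near x z.
Proof.
move=> [B B0 h] [B' B'0 h']; exists (B + B'); first exact: addr_ge0.
move=> m; have -> : x m - z m = (x m - y m) + (y m - z m) by ring.
by apply: geD; [apply: nearW h m|apply: nearW h' m]; lra.
Qed.

Local Lemma nearD x y s t : near x s -> near y t ->
  near (fun m => x m + y m) (fun m => s m + t m).
Proof.
move=> [B B0 h] [B' B'0 h']; exists (B + B'); first exact: addr_ge0.
move=> m; have -> : x m + y m - (s m + t m) = (x m - s m) + (y m - t m) by ring.
by apply: geD; [apply: nearW h m|apply: nearW h' m]; lra.
Qed.

Local Lemma nearMr x s (y : tilt) : near x s ->
  near (fun m => x m * y m) (fun m => s m * y m).
Proof.
move=> [B B0 h]; have [B' B'0 h'] := tilt_bd y.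
exists (B + B'); first exact: addr_ge0.
by move=> m; rewrite -mulrBl; apply: geW (geM (h m) (h' m)); lra.
Qed.

Local Lemma near_refl x : near x x.
Proof.
exists 0 => // m; rewrite subrr; exact: ge0.
Qed.

Local Lemma near_uniq (x y : tilt) : near x y -> x = y.
Proof.
move=> [B B0 h]; have [B1 B10 h1] := tilt_bd x; have [B2 B20 h2] := tilt_bd y.
apply: tilt_eq => n; apply/eqP; rewrite -subr_eq0; apply/eqP.
pose D := B + B1 + B2; apply: (@ge_inf _ (D / P ^+ n)) => k.
rewrite (tilt_pow x n k) (tilt_pow y n k).
have -> : D / P ^+ n = P ^+ k * (D / P ^+ (n + k)).
  by rewrite exprD; field; rewrite !Pkn0.
have xD : bd x D by apply: bdW h1; rewrite /D; lra.
have yD : bd y D by apply: bdW h2; rewrite /D; lra.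
have xyD : near_ x y D by apply: nearW h; rewrite /D; lra.
have := pwk k (lexx 1) (xD (n + k)%N) (yD _) (xyD _).
by apply: geW; lra.
Qed.

Local Lemma near_uniq' (x y : tilt) s : near x s -> near y s -> x = y.
Proof. by move=> hx hy; apply: near_uniq; apply: near_trans hx (near_sym hy). Qed.

Local Lemma ac_add (x y : tilt) : ac (fun m => x m + y m).
Proof.
have [B B0 hx] := tilt_bd x; have [B' B'0 hy] := tilt_bd y.
have xD : bd x (B + B') by apply: bdW hx; lra.
have yD : bd y (B + B') by apply: bdW hy; lra.
exists (B + B'); first exact: addr_ge0; split=> m; first exact: geD.
rewrite -(tseqP x m) -(tseqP y m) opprD addrA.
have := @frob (x m.+1) (y m.+1) ((B + B') / P ^+ m.+1) 0 (lexx _) (xD _).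
rewrite sub0r => /(_ (yD _)); apply: geW.
by rewrite addr0 exprS le_eqVlt; apply/orP; left; apply/eqP; field; rewrite Pn0 Pkn0.
Qed.

Local Lemma ac_opp (x : tilt) : ac (fun m => - x m).
Proof.
have [B B0 hx] := tilt_bd x.
exists B => //; split=> m; first exact: geN.
rewrite -(tseqP x m) opprK.
have := @frob (x m.+1) (- x m.+1) (B / P ^+ m.+1) 0 (lexx _) (hx _).
rewrite sub0r => /(_ (geN (hx _))) /geN.
rewrite subrr expr0n gtn_eqF// sub0r opprB opprK; apply: geW.
by rewrite addr0 exprS le_eqVlt; apply/orP; left; apply/eqP; field; rewrite Pn0 Pkn0.
Qed.

Definition tilt_add (x y : tilt) : tilt :=
  MkTilt (tlimP (ac_add x y)).

Definition tilt_opp (x : tilt) : tilt := MkTilt (tlimP (ac_opp x)).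

Lemma tilt_zero_subproof (n : nat) : (0 : C) ^+ p = 0.
Proof. by rewrite expr0n gtn_eqF. Qed.

Definition tilt_zero : tilt := MkTilt tilt_zero_subproof.

Lemma tilt_one_subproof (n : nat) : (1 : C) ^+ p = 1.
Proof. exact: expr1n. Qed.

Definition tilt_one : tilt := MkTilt tilt_one_subproof.

Lemma tilt_mul_subproof (x y : tilt) n : (x n.+1 * y n.+1) ^+ p = x n * y n.
Proof. by rewrite exprMn !tseqP. Qed.

Definition tilt_mul (x y : tilt) : tilt := MkTilt (tilt_mul_subproof x y).

Lemma tilt_inv_subproof (x : tilt) n : (x n.+1)^-1 ^+ p = (x n)^-1.
Proof. by rewrite exprVn tseqP. Qed.

Definition tilt_inv (x : tilt) : tilt := MkTilt (tilt_inv_subproof x).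

Local Lemma nadd x y : near (tilt_add x y) (fun m => x m + y m).
Proof. exact: tlim_near (ac_add x y). Qed.
Local Lemma nopp x : near (tilt_opp x) (fun m => - x m).
Proof. exact: tlim_near (ac_opp x). Qed.

Local Lemma eq_near x s t : near x s -> s =1 t -> near x t.
Proof. by move=> h /funext <-. Qed.

Lemma tilt_addA : associative tilt_add.
Proof.
move=> x y z; apply: (@near_uniq' _ _ (fun m => x m + (y m + z m))).
  exact: near_trans (nadd _ _) (nearD (near_refl _) (nadd _ _)).
apply: eq_near (near_trans (nadd _ _) (nearD (nadd _ _) (near_refl _))) _ => m.
by rewrite /= addrA.
Qed.

Lemma tilt_addC : commutative tilt_add.
Proof.
move=> x y; apply: (near_uniq' (nadd _ _)); apply: eq_near (nadd _ _) _ => m.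
by rewrite addrC.
Qed.

Lemma tilt_add0 : left_id tilt_zero tilt_add.
Proof.
move=> x; apply: (near_uniq' (nadd _ _)).
by apply: eq_near (near_refl x) _ => m; rewrite add0r.
Qed.

Lemma tilt_addN : left_inverse tilt_zero tilt_opp tilt_add.
Proof.
move=> x; apply: near_uniq; apply: near_trans (nadd _ _) _.
by apply: eq_near (nearD (nopp x) (near_refl x)) _ => m /=; rewrite addNr.
Qed.

HB.instance Definition _ :=
  GRing.isZmodule.Build tilt tilt_addA tilt_addC tilt_add0 tilt_addN.

Lemma tilt_mulA : associative tilt_mul.
Proof. by move=> x y z; apply: tilt_eq => n /=; rewrite mulrA. Qed.

Lemma tilt_mulC : commutative tilt_mul.
Proof. by move=> x y; apply: tilt_eq => n /=; rewrite mulrC. Qed.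

Lemma tilt_mul1 : left_id tilt_one tilt_mul.
Proof. by move=> x; apply: tilt_eq => n /=; rewrite mul1r. Qed.

Lemma tilt_mulDl : left_distributive tilt_mul +%R.
Proof.
move=> x y z; apply: (@near_uniq' _ _ (fun m => x m * z m + y m * z m)).
  by apply: eq_near (nearMr z (nadd x y)) _ => m; rewrite mulrDl.
exact: nadd.
Qed.

Lemma tilt_oner_neq0 : tilt_one != 0.
Proof.
apply/eqP => /(congr1 (fun x : tilt => x 0%N)) /= /eqP; apply/negP; exact: oner_neq0.
Qed.

HB.instance Definition _ := GRing.Zmodule_isComNzRing.Build tilt
  tilt_mulA tilt_mulC tilt_mul1 tilt_mulDl tilt_oner_neq0.

Lemma tilt_neq0 (x : tilt) n : x != 0 -> x n != 0.
Proof.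
apply: contra => /eqP xn0; apply/eqP; apply: tilt_eq => m /=.
apply/eqP; have := tilt_pow x m n; rewrite addnC => ->.
have: x (n + m)%N ^+ (p ^ m) = 0 by rewrite -tilt_pow.
by move=> /eqP; rewrite expf_eq0 => /andP[_ /eqP ->]; rewrite expr0n expn_eq0 gtn_eqF.
Qed.

Lemma tilt_mulV (x : tilt) : x != 0 -> tilt_inv x * x = 1.
Proof. by move=> x0; apply: tilt_eq => n /=; rewrite mulVf// tilt_neq0. Qed.

Lemma tilt_inv0 : tilt_inv 0 = 0.
Proof. by apply: tilt_eq => n /=; rewrite invr0. Qed.

HB.instance Definition _ := GRing.ComNzRing_isField.Build tilt tilt_mulV tilt_inv0.

Local Lemma nnat n : near (n%:R : tilt) (fun=> n%:R).
Proof.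
elim: n => [|n ih]; first exact: near_refl.
rewrite -natr1; apply: near_trans (nadd _ _) _.
by apply: eq_near (nearD ih (near_refl _)) _ => m /=; rewrite natr1.
Qed.

Lemma pchar_tilt : p \in [pchar tilt].
Proof.
rewrite inE pp /=; apply/eqP/near_uniq; apply: near_trans (nnat p) _.
exists 0 => // m; rewrite /= subr0 mul0r subr0; exact: gep.
Qed.

Lemma tilt_addE (x y : tilt) n :
  vcvg (@vp R p C) (fun k => (x (n + k)%N + y (n + k)%N) ^+ (p ^ k)) ((x + y) n).
Proof. by have [B _ /(tlim_cvg n) []] := ac_add x y. Qed.

Lemma tilt_mulE (x y : tilt) n : (x * y) n = x n * y n.
Proof. by []. Qed.

End Tilt.

Section NonPerfect.
Variables (R : realType) (p : nat) (C : CpField R p) (u eta : tilt C).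

(* A power series of F_p[[X, Y]] is given by its coefficients.  As the tilt has
   characteristic p, the image of c : 'F_p in the tilt is (c : nat)%:R. *)
Definition partial_sum (F : nat -> nat -> 'F_p) (n : nat) : tilt C :=
  \sum_(i < n.+1) \sum_(j < n.+1) (F i j : nat)%:R * u ^+ i * eta ^+ j.

Definition is_expansion (F : nat -> nat -> 'F_p) (f : tilt C) :=
  vcvg (@vflat R p C) (partial_sum F) f.

Definition Enp_plus : set (tilt C) := [set f | exists F, is_expansion F f].

(* The expansion of an element of [Enp_plus] is unique: u and eta = eps - 1
   satisfy no nontrivial power series relation over F_p. *)
Definition coefs (f : tilt C) : nat -> nat -> 'F_p :=
  xget (fun _ _ => 0) [set F | is_expansion F f].

(* The infimum is a minimum unless f has no nonzero coefficient, in which case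
   it is +oo. *)
Definition vmono (f : tilt C) : \bar R :=
  ereal_inf [set (ij.1%:R%:E * vflat u + ij.2%:R%:E * vflat eta)%E
            | ij in [set ij : nat * nat | coefs f ij.1 ij.2 != 0]].

End NonPerfect.

Definition Gamma (R : realType) (s : R) : R :=
  (\int[lebesgue_measure]_(x in `]0, +oo[) (x `^ (s - 1) * expR (- x)))%R.

(* t is meant to be nonnegative, so that the ceiling is a natural number. *)
Definition frakM (R : realType) (p : nat) (t : R) : rat :=
  let n := `|Num.ceil t|%N in
  p%:R ^+ (2 * n + 3) / (p%:R - 1) *
    (\prod_(0 <= k < n.+1) (k%:R + (p%:R + 1) / p%:R) ^+ 2)
  - (p%:R - 1) *
    \sum_(0 <= k < n.+1)
      (k%:R + 1) * p%:R ^+ k * \prod_(0 <= l < k) (l%:R + (p%:R + 1) / p%:R).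

Lemma frakM_gt0 (R : realType) (p : nat) (t : R) : (1 < p)%N -> 0 < frakM p t.
Proof.
move=> p1; rewrite /frakM; set n := `|_|%N; move: n => n.
set P : rat := p%:R; have P1 : 1 < P by rewrite /P ltr1n.
pose a (k : nat) := k%:R + (P + 1) / P.
pose Q (k : nat) := P ^+ k * \prod_(0 <= l < k) a l.
have QS k : Q k.+1 = (P * k%:R + P + 1) * Q k.
  by rewrite /Q big_nat_recr//= exprS /a; field; lra.
have Q1 k : 1 <= Q k.
  elim: k => [|k ih]; first by rewrite /Q big_geq// mulr1 expr0.
  rewrite QS; have : 0 <= (P * k%:R + P) * Q k.
    by apply: mulr_ge0; [rewrite addr_ge0// ?mulr_ge0//|]; lra.
  lra.
have S m : (P - 1) * \sum_(0 <= k < m) (k%:R + 1) * P ^+ k * \prod_(0 <= l < k) a l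
    <= Q m - 1.
  elim: m => [|m ih]; first by rewrite big_geq// mulr0 /Q big_geq// mulr1 expr0 subrr.
  rewrite big_nat_recr//= mulrDr -mulrA -/(Q m) QS.
  have : 0 <= (m%:R + 1) * Q m by rewrite mulr_ge0 ?addr_ge0//; have := Q1 m; lra.
  lra.
have := S n.+1; rewrite -/a; set s := _ * \sum_(_ <= _ < _) _ => hs.
have -> : P ^+ (2 * n + 3) / (P - 1) * \prod_(0 <= k < n.+1) (a k) ^+ 2 =
    P / (P - 1) * Q n.+1 ^+ 2.
  rewrite prodrXl /Q (_ : 2 * n + 3 = (n.+1 + n.+1).+1)%N; last lia.
  by rewrite exprS exprD; field; lra.
have : Q n.+1 <= P / (P - 1) * Q n.+1 ^+ 2.
  have h : 1 <= P / (P - 1) by rewrite ler_pdivlMr; lra.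
  rewrite -[leLHS]mul1r ler_pM//; [by have := Q1 n.+1; lra|].
  by rewrite expr2 ler_peMr//; have := Q1 n.+1; lra.
lra.
Qed.

(* Main.v *)
From HB Require Import structures.
Require Import Defs.
From mathcomp Require Import all_boot all_order all_algebra.
From mathcomp Require Import all_classical all_reals all_analysis.
From mathcomp Require Import measurable_realfun.
From mathcomp Require Import ring lra zify.

(** For a polynomial f over F_p, the elements f(u, eta) and f(u * eps^a, eta)
    have the same valuation.  This is seen modulo p on the n-th components,
    where u and eps become pi = p^(1/p^n) and a primitive p^n-th root of unity
    z.  Let K be the closure of Q(z).  As Q(z) is abelian over Q and p > 2, a p-th
    root of p in K could be multiplied by a root of unity so as to become
    rational.  So K contains no such root, X^(p^n) - p is irreducible over K,
    and 1, pi, ..., pi^(p^n - 1) is a basis of K(pi) over the complete field K.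
    The two valuations g(pi) |-> v(g(pi)) and g(pi) |-> v(g(pi z^a)) then
    differ by a bounded amount, hence are equal, as both are multiplicative.

    Now let (i0, j0) be a monomial of least value t in f, with i0 largest.  The
    operators W_{k+1}(a) = W_k(a + 1) - eps^k W_k(a), starting from
    W_0(a) = f(u * eps^a, eta), do not decrease valuations.  In W_{i0}(0) the
    monomials with i < i0 are killed and the others are multiplied by
    prod_{l < i0} (eps^i - eps^l), whose valuation is least at i = i0 because
    Gaussian binomials are integral.  So the monomial (i0, j0) dominates, and
    v(f) <= t + sum_{d <= i0} v(eps^d - 1) <= t + v(eta) * i0^2, which is far
    below M(t).

    The estimate of M(t) follows from Gamma(s + 1) = s * Gamma(s). *)

Set Implicit Arguments.
Unset Strict Implicit.
Unset Printing Implicit Defensive.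

Import Order.TTheory GRing.Theory Num.Theory.
Import numFieldNormedType.Exports.

Local Open Scope classical_set_scope.
Local Open Scope ring_scope.

(** * Valuations *)

(** These axioms are isolated because C_p and its tilt both satisfy them, so that the lemmas of this
    part serve both fields. *)
Definition is_valuation (R : realType) (K : fieldType) (v : K -> \bar R) :=
  [/\ forall x, (v x == +oo%E) = (x == 0),
      forall x, x != 0 -> v x \is a fin_num,
      forall x y, v (x * y) = (v x + v y)%E
    & forall x y, (mine (v x) (v y) <= v (x + y)%R)%E].

Section Valuation.
Variables (R : realType) (K : fieldType) (v : K -> \bar R).
Hypothesis hv : is_valuation v.
Implicit Types (x y : K) (r s : R).

Local Notation "x >=v r" := ((r%:E <= v x)%E) (at level 70).
Local Notation "x =v r" := (v x = r%:E) (at level 70).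

Lemma val0 : v 0 = +oo%E.
Proof. by have [h _ _ _] := hv; apply/eqP; rewrite h. Qed.

Lemma vge0 r : 0 >=v r.
Proof. by rewrite val0 leey. Qed.

Lemma vvalM x y : v (x * y) = (v x + v y)%E.
Proof. by have [_ _ h _] := hv. Qed.

Lemma vgeD x y r : x >=v r -> y >=v r -> x + y >=v r.
Proof.
have [_ _ _ h] := hv => hx hy; apply: le_trans (h x y).
by rewrite le_min hx hy.
Qed.

Lemma vgeM x y r s : x >=v r -> y >=v s -> x * y >=v (r + s).
Proof. by move=> hx hy; rewrite vvalM EFinD leeD. Qed.

Lemma vgeW x r s : s <= r -> x >=v r -> x >=v s.
Proof. by move=> h; apply: le_trans; rewrite lee_fin. Qed.

Lemma veq_neq0 x r : x =v r -> x != 0.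
Proof. by move=> h; apply/eqP => x0; rewrite x0 val0 in h. Qed.

Lemma veqP x : x != 0 -> exists r, x =v r.
Proof.
have [_ h _ _] := hv => x0; exists (fine (v x)).
by rewrite fineK// h.
Qed.

Lemma veq1 : 1 =v 0.
Proof.
have [r hr] := veqP (oner_neq0 K).
have := vvalM 1 1; rewrite mulr1 hr -EFinD => -[h].
by congr EFin; lra.
Qed.

Lemma veqN1 : -1 =v 0.
Proof.
have [r hr] : exists r, -1 =v r by apply: veqP; rewrite oppr_eq0 oner_neq0.
have := vvalM (-1) (-1); rewrite mulrNN mulr1 hr veq1 -EFinD => -[h].
by congr EFin; lra.
Qed.

Lemma valN x : v (- x) = v x.
Proof. by rewrite -mulN1r vvalM veqN1 add0e. Qed.

Lemma valB x y : v (x - y) = v (y - x).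
Proof. by rewrite -opprB valN. Qed.

Lemma vgeB x y r : x >=v r -> y >=v r -> x - y >=v r.
Proof. by move=> hx hy; apply: vgeD; rewrite ?valN. Qed.

Lemma veqM x y r s : x =v r -> y =v s -> x * y =v (r + s).
Proof. by move=> hx hy; rewrite vvalM hx hy. Qed.

Lemma veqX x r n : x =v r -> x ^+ n =v (n%:R * r).
Proof.
move=> h; elim: n => [|n ih]; first by rewrite expr0 mul0r veq1.
by rewrite exprS (veqM h ih) -natr1 mulrDl mul1r addrC.
Qed.

Lemma vgeX x r n : x >=v r -> x ^+ n >=v (n%:R * r).
Proof.
move=> h; elim: n => [|n ih]; first by rewrite expr0 mul0r veq1.
by rewrite exprS -natr1 mulrDl mul1r addrC; apply: vgeM.
Qed.

Lemma veqV x r : x =v r -> x^-1 =v (- r).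
Proof.
move=> h; have x0 := veq_neq0 h.
have [s hs] : exists s, x^-1 =v s by apply: veqP; rewrite invr_eq0.
have := veqM h hs; rewrite divff// veq1 hs => -[e].
by congr EFin; lra.
Qed.

Lemma vge1 : 1 >=v 0. Proof. by rewrite veq1. Qed.

Lemma vge_nat n : n%:R >=v 0.
Proof.
elim: n => [|n ih]; first exact: vge0.
by rewrite -natr1; apply: vgeD => //; exact: vge1.
Qed.

Lemma vge_sum (I : Type) (l : seq I) (P : pred I) (F : I -> K) r :
  (forall i, P i -> F i >=v r) -> \sum_(i <- l | P i) F i >=v r.
Proof.
move=> h; elim/big_ind : _ => //; [exact: vge0|by move=> ? ?; apply: vgeD].
Qed.

Lemma vgeXn x r n : (0 < n)%N -> x ^+ n >=v r -> x >=v (r / n%:R).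
Proof.
move=> n0 h; have [->|x0] := eqVneq x 0; first exact: vge0.
have [s hs] := veqP x0; move: h; rewrite (veqX n hs) hs !lee_fin.
by rewrite ler_pdivrMr ?ltr0n// mulrC.
Qed.

Lemma veqXn x r n : (0 < n)%N -> x ^+ n =v r -> x =v (r / n%:R).
Proof.
move=> n0 h.
have x0 : x != 0.
  apply/eqP => e; move: h; rewrite e expr0n gtn_eqF//= => /veq_neq0.
  by rewrite eqxx.
have [s hs] := veqP x0; move: h; rewrite (veqX n hs) hs => -[<-].
by congr EFin; field; rewrite pnatr_eq0 -lt0n.
Qed.

Lemma veqD x y r : x =v r -> (r%:E < v y)%E -> x + y =v r.
Proof.
move=> hx hy; have [_ _ _ hD] := hv; apply/eqP; rewrite eq_le; apply/andP; split.
  rewrite leNgt; apply/negP => h.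
  have := hD (x + y) (- y); rewrite valN addrK hx leNgt => /negP; apply.
  by rewrite lt_min h.
by apply: vgeD; rewrite ?hx// ltW.
Qed.

Lemma veqDge x y r s : x =v r -> y >=v s -> r < s -> x + y =v r.
Proof.
by move=> hx hy rs; apply: veqD => //; apply: lt_le_trans hy; rewrite lte_fin.
Qed.

Lemma veq_congr x y r s : x =v r -> x - y >=v s -> r < s -> y =v r.
Proof.
move=> hx hd rs; rewrite -(subrKC x y); apply: (veqDge hx _ rs).
by rewrite valB.
Qed.

Lemma vge_congr x y r s : x >=v r -> x - y >=v s -> r <= s -> y >=v r.
Proof.
move=> hx hd rs; rewrite -(subrKC x y); apply: vgeD => //.
by rewrite valB; apply: vgeW hd.
Qed.

Lemma vgt_sum (I : Type) (l : seq I) (P : pred I) (F : I -> K) r :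
  (forall i, P i -> (r%:E < v (F i))%E) -> (r%:E < v (\sum_(i <- l | P i) F i))%E.
Proof.
have [_ _ _ hD] := hv.
move=> h; elim/big_ind : _ => //; first by rewrite val0 ltry.
by move=> x y hx hy; apply: lt_le_trans (hD x y); rewrite lt_min hx hy.
Qed.

Lemma veq_sum (I : finType) (F : I -> K) (i0 : I) r :
  F i0 =v r -> (forall i, i != i0 -> (r%:E < v (F i))%E) ->
  \sum_i F i =v r.
Proof.
by move=> h0 h; rewrite (bigD1 i0)//=; apply: veqD => //; apply: vgt_sum.
Qed.

(** Pigeonhole: if every factor had valuation below [r / n], the product would have valuation below
    [r]. *)
Lemma vge_prod_factor n (F : 'I_n -> K) r : (0 < n)%N ->
  \prod_(i < n) F i >=v r -> exists i, F i >=v (r / n%:R).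
Proof.
move=> n0; set s := r / n%:R => h.
apply: contrapT => /forallNP H.
have Hi i : exists2 t, t < s & F i =v t.
  have Fi0 : F i != 0 by apply/eqP => e; apply: (H i); rewrite e vge0.
  have [t ht] := veqP Fi0; exists t => //.
  by rewrite ltNge; apply/negP => le; apply: (H i); rewrite ht lee_fin.
have [t tlt ht] : exists2 t : 'I_n -> R, (forall i, t i < s) & forall i, F i =v t i.
  have [t ht] := choice (fun i => (let: ex_intro2 t a b := Hi i in
    ex_intro (fun t => t < s /\ F i =v t) t (conj a b))).
  by exists t => i; have [] := ht i.
have e : \prod_(i < n) F i =v \sum_(i < n) t i.
  by elim/big_ind2 : _ => [|x1 x2 y1 y2 h1 h2|i _]; rewrite ?veq1 ?(veqM h1 h2).
move: h; rewrite e lee_fin leNgt => /negP; apply.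
have -> : r = \sum_(i < n) s.
  by rewrite sumr_const card_ord -mulr_natr /s divfK// pnatr_eq0 -lt0n.
by apply: ltr_sum => //; apply/hasP; exists (Ordinal n0); rewrite ?mem_index_enum.
Qed.

Lemma vge_all0 x : (forall r, x >=v r) -> x = 0.
Proof.
move=> h; apply/eqP; apply: contraT => /veqP[r hr].
by have := h (r + 1); rewrite hr lee_fin; lra.
Qed.

Lemma vge_lim (s : nat -> K) l r : vcvg v s l -> (forall n, s n >=v r) -> l >=v r.
Proof.
move=> cvg h; have [N hN] := cvg r.
by apply: (@vge_congr (s N)) (lexx r); [exact: h|exact: hN].
Qed.

Lemma vge_horner (q : {poly K}) x r : x >=v 0 -> (forall i, q`_i >=v r) -> q.[x] >=v r.
Proof.
move=> hx hq; rewrite horner_coef; apply: vge_sum => i _.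
rewrite -[r]addr0; apply: vgeM => //.
by have := vgeX i hx; rewrite mulr0.
Qed.

End Valuation.

Lemma vp_valuation (R : realType) (p : nat) (C : CpField R p) : is_valuation (@vp R p C).
Proof. by split; [exact: vp_eqy|exact: vp_fin|exact: vpM|exact: vpD]. Qed.

(** * Cyclotomic integers *)

(** The cyclotomic polynomial of order [p ^ n.+1]. *)
Definition cycpoly (p n : nat) : {poly int} := \sum_(k < p) 'X^(k * p ^ n).

Lemma cycpoly_size_monic (p n : nat) : (0 < p)%N ->
  size (cycpoly p n) = (p ^ n * p.-1).+1 /\ cycpoly p n \is monic.
Proof.
case: p => // p _; rewrite /cycpoly big_ord_recr/= [(p * _)%N]mulnC.
set N := (_ * p)%N.
have szlt : (size (\sum_(k < p) 'X^(k * p.+1 ^ n) : {poly int})%R < size ('X^N : {poly int})%R)%N.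
  rewrite size_polyXn ltnS; apply: leq_trans (size_sum _ _ _) _.
  apply/bigmax_leqP => i _; rewrite size_polyXn /N mulnC ltn_pmul2l//.
  by rewrite expn_gt0.
rewrite addrC; split; first by rewrite size_polyDl// size_polyXn.
by rewrite monicE lead_coefDl// lead_coefXn.
Qed.

(** It reduces sums over the exponents prime to [p], hence over conjugates, to sums over full
    ranges. *)
Lemma sum_coprime_split (V : zmodType) (p M : nat) (F : nat -> V) : prime p ->
  \sum_(0 <= c < p * M) F c =
  \sum_(0 <= c < p * M | coprime p c) F c + \sum_(0 <= c < M) F (p * c)%N.
Proof.
move=> pp; elim: M => [|M ih]; first by rewrite muln0 !big_geq// addr0.
have pM : (p * M <= p * M.+1)%N by rewrite leq_pmul2l ?prime_gt0.
rewrite (big_cat_nat (leq0n _) pM)//= ih [in RHS](big_cat_nat (leq0n _) pM)//= big_nat_recr//=.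
rewrite -!addrA; congr (_ + _); rewrite addrCA; congr (_ + _).
have ppM : (p * M < p * M.+1)%N by rewrite ltn_pmul2l ?prime_gt0.
rewrite big_ltn// [in RHS]big_ltn_cond// prime_coprime// dvdn_mulr//= [in RHS]addrC.
congr (_ + _); rewrite [RHS]big_nat_cond [LHS]big_nat_cond; apply: eq_bigl => c.
rewrite prime_coprime// andbT; case: (ltnP (p * M) c) => //= cM.
case: (ltnP c (p * M.+1)) => //= cM'; apply/esym/negP => /dvdnP[k ek].
by move: cM cM'; rewrite ek ![(p * _)%N]mulnC !ltn_pmul2r ?prime_gt0//; lia.
Qed.

Section Cyclotomic.
Variables (R : realType) (p : nat) (C : CpField R p).
Hypothesis p_gt2 : (2 < p)%N.

Local Notation v := (@vp R p C).
Local Notation "x >=v r" := ((r%:E <= v x)%E) (at level 70).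
Local Notation "x =v r" := (v x = r%:E) (at level 70).
Local Notation hv := (vp_valuation C).
Local Notation "h ^C" := (map_poly (intr : int -> C) h).
Local Notation pp := (Cp_prime C).

(** Bezout writes 1 as [b * p - a * m]; since [p] has valuation 1, [m] can neither be 0 in C nor
    have positive valuation. *)
Lemma vp_coprime m : coprime p m -> (m%:R : C) =v 0.
Proof.
move=> cop; have [m0|m0] := eqVneq (m%:R : C) 0.
  have [a _ /dvdnP[b e]] := Bezoutl m (prime_gt0 pp).
  move: e; rewrite (eqP cop) => /(congr1 (fun n => n%:R : C)).
  rewrite natrD !natrM m0 mulr0 addr0 => /(congr1 v).
  rewrite (veq1 hv) (vvalM hv) vp_p => e.
  have : (b%:R * p%:R : C) >=v 1.
    rewrite -[X in (X%:E <= _)%E]add0r.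
    by apply: (vgeM hv); [exact: (vge_nat hv)|rewrite vp_p].
  by rewrite (vvalM hv) vp_p -e lee_fin ler10.
have [r hr] := veqP hv m0.
have r0 : 0 <= r by have := vge_nat hv m; rewrite hr lee_fin.
apply/eqP; rewrite hr eqe eq_le r0 andbT leNgt; apply/negP => rgt0.
have [a _ /dvdnP[b e]] := Bezoutl m (prime_gt0 pp).
move: e; rewrite (eqP cop) => /(congr1 (fun n => n%:R : C)).
rewrite natrD !natrM => e.
have : (1 : C) >=v Num.min r 1.
  have -> : (1 : C) = b%:R * p%:R - a%:R * m%:R by rewrite -e; ring.
  apply: (vgeB hv).
    rewrite -[X in (X%:E <= _)%E]add0r; apply: (vgeM hv); first exact: (vge_nat hv).
    by rewrite vp_p lee_fin ge_min lexx orbT.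
  rewrite -[X in (X%:E <= _)%E]add0r; apply: (vgeM hv); first exact: (vge_nat hv).
  by rewrite hr lee_fin ge_min lexx.
by rewrite (veq1 hv) lee_fin ge_min; lra.
Qed.

Lemma vp_nat n : (0 < n)%N -> (n%:R : C) =v (logn p n)%:R.
Proof.
move=> n0; have [m cop e] := pfactor_coprime pp n0.
rewrite {1}e natrM natrX (veqM hv (vp_coprime cop) (veqX hv _ (@vp_p R p C))).
by rewrite mulr1 add0r.
Qed.

Lemma vp_int (z : int) : z != 0 -> (z%:~R : C) =v (logn p `|z|)%:R.
Proof.
by case: z => n n0; rewrite ?NegzE ?mulrNz ?(valN hv) ?abszN; apply: vp_nat; rewrite ?lt0n.
Qed.

Lemma intC_eq0 (z : int) : ((z%:~R : C) == 0) = (z == 0).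
Proof.
have [->|z0] := eqVneq z 0; first by rewrite eqxx.
by apply/negbTE; apply: (veq_neq0 hv (vp_int z0)).
Qed.

Lemma unity_root_val n (z : C) : (0 < n)%N -> z ^+ n = 1 -> z =v 0.
Proof.
move=> n0 h; have := @veqXn _ _ _ hv z 0 n n0; rewrite h (veq1 hv) mul0r.
exact.
Qed.

Let predp : p.-1%:R = p%:R - 1 :> R.
Proof. by rewrite -subn1 natrB// prime_gt0// pp. Qed.

(** Dividing the expansion of [(1 + l) ^+ p = 1] by [l] gives [l ^+ p.-1 = - S], where all terms of
    [S] are multiples of [p] and the term [i = 0] is [p] itself. *)
Lemma prim_root_p_val (w : C) : p.-primitive_root w -> (w - 1) =v (p%:R - 1)^-1.
Proof.
move=> pw; set l := w - 1.
have l0 : l != 0.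
  rewrite subr_eq0; apply/eqP => w1; have := prim_order_dvd pw 1.
  by rewrite w1 expr1n eqxx dvdn1 => /esym/eqP; lia.
have lge : l >=v 0.
  apply: (vgeB hv); last exact: (vge1 hv).
  by rewrite (unity_root_val (prime_gt0 pp) (prim_expr_order pw)).
pose S := \sum_(i < p.-1) (l ^+ i) *+ 'C(p, i.+1).
have e : l ^+ p.-1 = - S.
  have := Defs.exprD_middle 1 l (prime_gt0 pp).
  rewrite [1 + l]subrKC (prim_expr_order pw) expr1n => h.
  have eS : l * S = \sum_(i < p.-1) (1 ^+ (p - i.+1) * l ^+ i.+1) *+ 'C(p, i.+1).
    by rewrite mulr_sumr; apply: eq_bigr => i _; rewrite expr1n mul1r exprS mulrnAr.
  apply: (mulfI l0); rewrite -exprS prednK ?prime_gt0 ?pp// mulrN eS.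
  by apply/eqP; rewrite -addr_eq0; apply/eqP; apply: (addrI 1); rewrite addr0 addrA -h.
have binE (i : 'I_p.-1) : exists m, 'C(p, i.+1) = (p * m)%N.
  have /dvdnP[m ->] : (p %| 'C(p, i.+1))%N.
    by apply: prime_dvd_bin; [exact: pp|have := ltn_ord i; lia].
  by exists m; rewrite mulnC.
have ti (i : 'I_p.-1) r : l >=v r -> ((l ^+ i) *+ 'C(p, i.+1)) >=v (1 + i%:R * r).
  move=> hr; have [m ->] := binE i; rewrite mulnC mulrnA -[X in v X]mulr_natl.
  apply: (vgeM hv); first by rewrite vp_p.
  by rewrite -[X in v X]mulr_natl -[X in (X%:E <= _)%E]add0r; apply: (vgeM hv) => //; [exact: (vge_nat hv)|apply: (vgeX hv)].
(* This positive lower bound pushes the terms of [S] with [i > 0] above valuation 1, so that [p]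
   dominates. *)
have lpos : l >=v (1 / p.-1%:R).
  apply: (vgeXn hv); first by lia.
  rewrite e (valN hv); apply: (vge_sum hv) => i _.
  by have := ti i 0 lge; rewrite mulr0 addr0.
have p10 : (0 < p.-1)%N by lia.
rewrite -predp -[_^-1]mul1r; apply: (veqXn hv) => //.
rewrite e (valN hv); apply: (veq_sum hv (i0 := Ordinal p10)).
  by rewrite /= bin1 expr0 vp_p.
move=> i i0; apply: lt_le_trans (ti i _ lpos); rewrite lte_fin.
have : 0 < i%:R * (1 / p.-1%:R) :> R; last lra.
rewrite mulr_gt0// ?divr_gt0 ?ltr0n// lt0n.
by apply: contra i0 => /eqP i0; apply/eqP/val_inj.
Qed.

Lemma prim_root_pX n (z : C) : (p ^ n.+1).-primitive_root z ->
  (p ^ n).-primitive_root (z ^+ p).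
Proof.
move=> hz; have := dvdn_prim_root hz (_ : (p ^ n %| p ^ n.+1)%N).
by rewrite expnS mulnK ?expn_gt0 ?prime_gt0 ?pp//; apply; rewrite dvdn_mull.
Qed.

(** Modulo [p], [l ^+ p] agrees with [z ^+ p - 1], whose valuation is known by induction and is less
    than 1; that of [l] is obtained by dividing by [p]. *)
Lemma prim_root_val n (z : C) : (p ^ n.+1).-primitive_root z ->
  (z - 1) =v ((p ^ n * p.-1)%:R)^-1.
Proof.
elim: n z => [|n ih] z hz.
  by rewrite expn0 mul1n predp; apply: prim_root_p_val; rewrite expn1 in hz.
set l := z - 1.
have hl := ih _ (prim_root_pX hz).
have lge : l >=v 0.
  apply: (vgeB hv); last exact: (vge1 hv).
  by rewrite (unity_root_val _ (prim_expr_order hz))// expn_gt0 prime_gt0 ?pp.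
have : (l ^+ p) =v ((p ^ n * p.-1)%:R)^-1.
  have := @Defs.frob R p C 1 l 0 0 (lexx _); rewrite mulr0 oppr0 !addr0.
  move=> /(_ (vge1 hv) lge); rewrite [1 + l]subrKC expr1n => h.
  apply: (veq_congr hv hl h).
  (* Strict even for [n = 0], because [p > 2]. *)
  have phi1 : (1 < p ^ n * p.-1)%N.
    by apply: leq_trans (_ : p.-1 <= _)%N; [lia|rewrite leq_pmull// expn_gt0 prime_gt0 ?pp].
  by rewrite invf_lt1 ?ltr0n ?ltr1n// ltnW.
move=> /(veqXn hv (prime_gt0 pp)) ->; congr EFin.
rewrite -invfM expnS -natrM; congr (_^-1); congr (_%:R).
by rewrite mulnC mulnA.
Qed.

(** * Expansions in powers of z - 1, for z a root of unity of fixed order *)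

Section Level.
Variable n : nat.
Local Notation N := (p ^ n.+1)%N.
Local Notation phi := (p ^ n * p.-1)%N.

Let N0 : (0 < N)%N. Proof. by rewrite expn_gt0 prime_gt0 ?pp. Qed.
Let phi0 : (0 < phi)%N.
Proof. by rewrite muln_gt0 expn_gt0 prime_gt0 ?pp//=; lia. Qed.

Lemma cycpoly_root (z : C) : N.-primitive_root z -> (cycpoly p n)^C.[z] = 0.
Proof.
move=> hz; rewrite /cycpoly rmorph_sum horner_sum.
under eq_bigr => k _ do rewrite rmorphXn/= map_polyX hornerXn mulnC exprM.
set w := z ^+ (p ^ n).
have w1 : w != 1.
  rewrite /w -(prim_order_dvd hz) expnS; apply/negP => /dvdn_leq.
  have := prime_gt1 pp; have : (0 < p ^ n)%N by rewrite expn_gt0 prime_gt0 ?pp.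
  by nia.
apply: (mulfI (_ : w - 1 != 0)); first by rewrite subr_eq0.
by rewrite -subrX1 /w -exprM -expnSr (prim_expr_order hz) subrr mulr0.
Qed.

(** Division by the monic cyclotomic polynomial, followed by the shift ['X + 1]. The point is that
    one [q] serves all primitive roots at once. *)
Lemma cyc_reduce (h : {poly int}) : exists2 q : {poly int}, (size q <= phi)%N &
  forall z : C, N.-primitive_root z -> h^C.[z] = q^C.[z - 1].
Proof.
have [szP mP] := cycpoly_size_monic n (prime_gt0 pp).
exists (Pdiv.Ring.rmodp h (cycpoly p n) \Po ('X + 1)).
  rewrite size_comp_poly2 ?size_XaddC//.
  by rewrite -ltnS -szP Pdiv.Ring.ltn_rmodpN0// monic_neq0.
move=> z hz; rewrite map_comp_poly horner_comp rmorphD/= rmorph1 map_polyX.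
rewrite hornerD hornerX hornerC subrK.
rewrite {1}(Pdiv.RingMonic.rdivp_eq mP h) rmorphD rmorphM/= hornerD hornerM.
by rewrite (cycpoly_root hz) mulr0 add0r.
Qed.

(* The terms have pairwise distinct valuations, since those of the
   coefficients are integers and 0 <= i < phi. *)
Lemma vge_terms (q : {poly int}) (l : C) r : (size q <= phi)%N ->
  l =v (phi%:R)^-1 -> q^C.[l] >=v r -> forall i, ((q`_i)%:~R * l ^+ i) >=v r.
Proof.
move=> sz hl hq i; have [->|qi] := eqVneq q`_i 0; first by rewrite mul0r (vge0 hv).
pose w (i : nat) := (logn p `|(q`_i)%R| * phi + i)%N.
have hw j : q`_j != 0 -> ((q`_j)%:~R * l ^+ j) =v ((w j)%:R / phi%:R).
  move=> qj; rewrite (veqM hv (vp_int qj) (veqX hv j hl)); congr EFin.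
  by rewrite /w natrD; set f := phi; rewrite natrM mulrDl mulfK// pnatr_eq0 -lt0n.
have isz : (i < size q)%N by rewrite ltnNge; apply: contra qi => /leq_sizeP ->.
case: (@arg_minnP _ (Ordinal isz) (fun j : 'I_(size q) => q`_j != 0) (fun j => w j) qi).
move=> j qj jmin.
suff hj : q^C.[l] =v ((w j)%:R / phi%:R).
  rewrite hj in hq; apply: le_trans hq _; rewrite hw// lee_fin.
  by rewrite ler_pM2r ?invr_gt0 ?ltr0n// ler_nat (jmin (Ordinal isz)).
rewrite horner_coef size_map_poly_id0 ?intC_eq0 ?lead_coef_eq0; last first.
  by apply/eqP => q0; rewrite q0 coef0 eqxx in qi.
apply: (veq_sum hv (i0 := j)); first by rewrite coef_map/= hw.
move=> k kj; rewrite coef_map/=.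
have [->|qk] := eqVneq q`_k 0; first by rewrite mul0r (val0 hv) ltry.
rewrite hw// lte_fin ltr_pM2r ?invr_gt0 ?ltr0n// ltr_nat.
rewrite ltn_neqAle jmin// andbT; apply: contra kj => /eqP.
rewrite /w => /(congr1 (modn^~ phi)); rewrite !modnMDl !modn_small => [e||].
- by apply/eqP/val_inj.
- exact: leq_trans (ltn_ord k) sz.
- exact: leq_trans (ltn_ord j) sz.
Qed.

(** By [vge_terms] each term of the expansion in [z - 1] satisfies the bound, and it keeps its
    valuation when [z - 1] is replaced by [z' - 1]. *)
Lemma conj_vge (h : {poly int}) (z z' : C) r :
  N.-primitive_root z -> N.-primitive_root z' -> h^C.[z] >=v r -> h^C.[z'] >=v r.
Proof.
move=> hz hz'; have [q sz e] := cyc_reduce h; rewrite !e// => hq.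
have ht := vge_terms sz (prim_root_val hz) hq.
rewrite horner_coef; apply: (vge_sum hv) => i _; rewrite coef_map/=.
have := ht i; rewrite !(vvalM hv).
by rewrite (veqX hv i (prim_root_val hz)) (veqX hv i (prim_root_val hz')).
Qed.

(** If the value is 0, [vge_terms] holds for every [r], so all terms of the expansion in [z - 1]
    vanish. *)
Lemma cyc_free (h : {poly int}) (z : C) : N.-primitive_root z ->
  (size h <= phi)%N -> h^C.[z] = 0 -> h = 0.
Proof.
move=> hz sz h0; pose q := h \Po ('X + 1).
have szq : (size q <= phi)%N by rewrite size_comp_poly2 ?size_XaddC.
have q0 : q^C.[z - 1] = 0.
  rewrite map_comp_poly horner_comp rmorphD/= rmorph1 map_polyX.
  by rewrite hornerD hornerX hornerC subrK.
have qz : q = 0.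
  apply/polyP => i; rewrite coef0; apply/eqP; rewrite -intC_eq0.
  have : (q`_i)%:~R * (z - 1) ^+ i = 0.
    apply: (vge_all0 hv) => r; apply: (vge_terms szq (prim_root_val hz)).
    by rewrite q0 (vge0 hv).
  move=> /eqP; rewrite mulf_eq0 expf_eq0 => /orP[//|/andP[_ /eqP e]].
  by have := veq_neq0 hv (prim_root_val hz); rewrite e eqxx.
apply/eqP; rewrite -size_poly_eq0 -(size_comp_poly2 h (size_XaddC 1)).
by rewrite -/q qz size_poly0.
Qed.

(** The gcd with the cyclotomic polynomial is constant, and a Bezout relation is evaluated at [z].
    Over the integers such a relation exists only up to nonzero scalars, hence [m] in place of 1. *)
Lemma cyc_inv (h : {poly int}) (z : C) : N.-primitive_root z -> h^C.[z] != 0 ->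
  exists g : {poly int}, exists2 m : int, m != 0 & h^C.[z] * g^C.[z] = m%:~R.
Proof.
move=> hz hn0; pose d := gcdp h (cycpoly p n).
have [szP mP] := cycpoly_size_monic n (prime_gt0 pp).
have P0 := monic_neq0 mP.
have d1 : (size d == 1)%N.
  have /Pdiv.Idomain.dvdpP[[k1 e1]/= k10 he1] := dvdp_gcdl h (cycpoly p n).
  have /Pdiv.Idomain.dvdpP[[k2 e2]/= k20 he2] := dvdp_gcdr h (cycpoly p n).
  have e20 : e2 != 0.
    by apply: contra P0 => /eqP e0; move: he2; rewrite e0 mul0r => /eqP; rewrite scale_poly_eq0 (negbTE k20).
  have d0 : d != 0.
    by apply: contra P0 => /eqP e0; move: he2; rewrite -/d e0 mulr0 => /eqP; rewrite scale_poly_eq0 (negbTE k20).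
  have dz : d^C.[z] != 0.
    apply: contra hn0 => /eqP d0'; move: he1 => /(congr1 (fun q => q^C.[z])).
    rewrite rmorphM hornerM -/d d0' mulr0 linearZ/= hornerZ => /eqP.
    by rewrite mulf_eq0 intC_eq0 (negbTE k10).
  (* As [d] does not vanish at [z], the cofactor [e2] does; by [cyc_free] it has full degree, which
     leaves degree 0 for [d]. *)
  have e2z : e2^C.[z] = 0.
    move: he2 => /(congr1 (fun q => q^C.[z])).
    rewrite rmorphM hornerM -/d linearZ/= hornerZ (cycpoly_root hz) mulr0 => /esym/eqP.
    by rewrite mulf_eq0 (negbTE dz) orbF => /eqP.
  have : (phi < size e2)%N.
    by rewrite ltnNge; apply: contra e20 => s; rewrite (cyc_free hz s e2z).
  move: he2 => /(congr1 (fun q : {poly int} => size q)); rewrite size_scale// szP -/d size_mul//.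
  have : (0 < size d)%N by rewrite size_poly_gt0.
  by move: (size e2) (size d) phi => a b c; lia.
have /Bezout_coprimepP[[a b]/=] : coprimep h (cycpoly p n) by [].
move=> /eqpP[[k1 k2]/= /andP[k10 k20] e].
exists (k1 *: a); exists k2 => //.
move: e => /(congr1 (fun q => q^C.[z])).
rewrite !linearZ/= !hornerZ rmorphD !rmorphM/= hornerD !hornerM (cycpoly_root hz).
by rewrite mulr0 addr0 rmorph1 hornerC mulr1 => <-; ring.
Qed.

Lemma sum_unity_root M (w : C) : w ^+ M = 1 ->
  exists m : int, \sum_(c < M) w ^+ c = m%:~R.
Proof.
move=> wM; have [->|w1] := eqVneq w 1.
  exists (M%:Z); under eq_bigr => c _ do rewrite expr1n.
  by rewrite sumr_const card_ord.
exists 0; apply: (mulfI (_ : w - 1 != 0)); first by rewrite subr_eq0.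
by rewrite -subrX1 wM subrr mulr0.
Qed.

(** A trace of an algebraic integer. By linearity it suffices to treat powers of [z], whose traces
    are differences of two geometric sums of roots of unity, each of them 0 or the number of its
    terms. *)
Lemma cyc_trace (h : {poly int}) (z : C) : N.-primitive_root z ->
  exists m : int, \sum_(0 <= c < N | coprime p c) h^C.[z ^+ c] = m%:~R.
Proof.
move=> hz; have zN := prim_expr_order hz.
have tr i : exists m : int, \sum_(0 <= c < N | coprime p c) (z ^+ c) ^+ i = m%:~R.
  have [m1 e1] : exists m : int, \sum_(c < N) (z ^+ i) ^+ c = m%:~R.
    by apply: sum_unity_root; rewrite -exprM mulnC exprM zN expr1n.
  have [m2 e2] : exists m : int, \sum_(c < p ^ n) (z ^+ (p * i)) ^+ c = m%:~R.
    apply: sum_unity_root; rewrite -exprM mulnAC -expnS exprM zN expr1n //.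
  exists (m1 - m2); rewrite rmorphB/= -e1 -e2.
  rewrite -(big_mkord predT (fun c => (z ^+ i) ^+ c)) -(big_mkord predT (fun c => (z ^+ (p * i)) ^+ c)).
  rewrite expnS (@sum_coprime_split C p (p ^ n) _ pp).
  have -> : \sum_(0 <= c < p ^ n) z ^+ i ^+ (p * c) = \sum_(0 <= c < p ^ n) z ^+ (p * i) ^+ c.
    by apply: eq_bigr => c _; rewrite -!exprM mulnA [(i * p)%N]mulnC.
  rewrite addrK; by apply: eq_bigr => c _; rewrite -!exprM mulnC.
have [m hm] := choice tr.
exists (\sum_(i < size h^C) h`_i * m i).
under eq_bigr => c _ do rewrite horner_coef.
rewrite exchange_big rmorph_sum/=; apply: eq_bigr => i _.
by rewrite rmorphM/= -hm mulr_sumr; apply: eq_bigr => c _; rewrite coef_map.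
Qed.

End Level.
End Cyclotomic.

(** * The closure of a cyclotomic field *)

Section Closure.
Variables (R : realType) (K : fieldType) (v : K -> \bar R).
Hypothesis hv : is_valuation v.

Lemma vclosure_sub (S : set K) x : S x -> vclosure v S x.
Proof. by move=> Sx A; exists x => //; rewrite subrr (vge0 hv). Qed.

Lemma vclosure_lim (S : set K) (s : nat -> K) l :
  (forall n, vclosure v S (s n)) -> vcvg v s l -> vclosure v S l.
Proof.
move=> hs cvg A; have [N hN] := cvg A; have [y Sy hy] := hs N A.
exists y => //; rewrite -(subrK (s N) l) -addrA; apply: (vgeD hv) => //.
by rewrite (valB hv); apply: hN.
Qed.

Definition vclosure_pred (S : {pred K}) : {pred K} :=
  fun x => `[< vclosure v [set x | x \in S] x >].

Lemma vclosure_predP (S : {pred K}) x :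
  reflect (vclosure v [set x | x \in S] x) (x \in vclosure_pred S).
Proof. exact: asboolP. Qed.

Lemma vclosure_divring (S : {pred K}) :
  divring_closed S -> divring_closed (vclosure_pred S).
Proof.
move=> [S1 SB SD].
have S0 : 0 \in S by rewrite -(subrr 1) SB.
split; first by apply/vclosure_predP/vclosure_sub.
  move=> x y /vclosure_predP hx /vclosure_predP hy; apply/vclosure_predP => A.
  have [x' Sx' hx'] := hx A; have [y' Sy' hy'] := hy A.
  exists (x' - y'); first exact: SB.
  have -> : x - y - (x' - y') = (x - x') - (y - y') by ring.
  exact: (vgeB hv).
move=> x y /vclosure_predP hx /vclosure_predP hy; apply/vclosure_predP.
have [->|y0] := eqVneq y 0; first by rewrite invr0 mulr0; apply: vclosure_sub.
have [s hs] := veqP hv y0.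
have [r hr] : exists r : R, (r%:E <= v x)%E.
  have [->|x0] := eqVneq x 0; first by exists 0; rewrite (vge0 hv).
  by have [r hr] := veqP hv x0; exists r; rewrite hr.
(* The first bound forces [y'] to have the valuation [s] of [y]; the other two make the two terms of
   the numerator of [x / y - x' / y'] at least [A + 2 * s], the denominator having valuation
   [2 * s]. *)
move=> A; pose B := Num.max (s + 1) (Num.max (A + 2 * s - r) (A + s)).
have [x' Sx' hx'] := hx B; have [y' Sy' hy'] := hy B.
have B1 : s + 1 <= B by rewrite le_max lexx.
have B2 : A + 2 * s - r <= B by rewrite !le_max lexx orbT.
have B3 : A + s <= B by rewrite !le_max lexx !orbT.
have hs' : v y' = s%:E by apply: (veq_congr hv hs hy'); lra.
have y'0 := veq_neq0 hv hs'.
exists (x' / y'); first exact: SD.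
have -> : x / y - x' / y' = (x * (y' - y) + y * (x - x')) * (y * y')^-1.
  by field; rewrite y0 y'0.
apply: (@vgeW _ _ _ _ ((A + 2 * s) + - (s + s))); first lra.
apply: (vgeM hv); last by rewrite (veqV hv (veqM hv hs hs')).
apply: (vgeD hv).
  apply: (@vgeW _ _ _ _ (r + B)); first lra.
  by apply: (vgeM hv); rewrite // (valB hv).
apply: (@vgeW _ _ _ _ (s + B)); first lra.
by apply: (vgeM hv); rewrite // hs.
Qed.

End Closure.

(** * The field Q(z) and its closure in C *)

Section CycField.
Variables (R : realType) (p : nat) (C : CpField R p) (z : C).
Local Notation "h ^C" := (map_poly (intr : int -> C) h).

(** The denominator is unrestricted: where it vanishes, the quotient is 0 by convention. *)
Definition cycfield : {pred C} :=
  fun x => `[< exists h g : {poly int}, x = h^C.[z] / g^C.[z] >].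

Lemma cycfieldP x :
  reflect (exists h g : {poly int}, x = h^C.[z] / g^C.[z]) (x \in cycfield).
Proof. exact: asboolP. Qed.

Lemma cycfield_poly (h : {poly int}) : h^C.[z] \in cycfield.
Proof. by apply/cycfieldP; exists h, 1; rewrite rmorph1 hornerC divr1. Qed.

Lemma cycfield_divring : divring_closed cycfield.
Proof.
split.
- by have := cycfield_poly 1; rewrite rmorph1 hornerC.
- move=> x y /cycfieldP[h1 [g1 ->]] /cycfieldP[h2 [g2 ->]]; apply/cycfieldP.
  have [g10|g10] := eqVneq g1^C.[z] 0.
    exists (- h2), g2; rewrite g10 invr0 mulr0 sub0r rmorphN hornerN.
    by rewrite mulNr.
  have [g20|g20] := eqVneq g2^C.[z] 0.
    by exists h1, g1; rewrite g20 invr0 mulr0 subr0.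
  exists (h1 * g2 - h2 * g1), (g1 * g2).
  by rewrite rmorphB !rmorphM/= hornerD hornerN !hornerM; field; rewrite g10 g20.
- move=> x y /cycfieldP[h1 [g1 ->]] /cycfieldP[h2 [g2 ->]]; apply/cycfieldP.
  exists (h1 * g2), (g1 * h2).
  by rewrite !rmorphM/= !hornerM invfM invrK invfM; ring.
Qed.

Definition cychat : {pred C} := vclosure_pred (@vp R p C) cycfield.

Lemma cychat_divring : divring_closed cychat.
Proof. exact: (vclosure_divring (vp_valuation C) cycfield_divring). Qed.

Lemma cychat_poly (h : {poly int}) : h^C.[z] \in cychat.
Proof.
by apply/vclosure_predP/(vclosure_sub (vp_valuation C))/cycfield_poly.
Qed.

Lemma cychat_lim (s : nat -> C) l : (forall n, s n \in cychat) ->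
  vcvg (@vp R p C) s l -> l \in cychat.
Proof.
move=> hs cvg; apply/vclosure_predP.
by apply: (vclosure_lim (vp_valuation C)) cvg => n; apply/vclosure_predP.
Qed.

HB.instance Definition _ := GRing.isDivringClosed.Build C cychat cychat_divring.

Record Cychat := MkCychat { cyc_val : C; cyc_valP : cyc_val \in cychat }.

HB.instance Definition _ := [isSub for cyc_val].
HB.instance Definition _ := [Choice of Cychat by <:].
HB.instance Definition _ := [SubChoice_isSubIntegralDomain of Cychat by <:].
HB.instance Definition _ := [SubIntegralDomain_isSubField of Cychat by <:].

Definition cyc_inc (x : Cychat) : C := cyc_val x.

Lemma cyc_inc_zmod : zmod_morphism cyc_inc. Proof. by []. Qed.

Lemma cyc_inc_monoid : monoid_morphism cyc_inc. Proof. by []. Qed.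

HB.instance Definition _ := GRing.isZmodMorphism.Build Cychat C cyc_inc cyc_inc_zmod.
HB.instance Definition _ := GRing.isMonoidMorphism.Build Cychat C cyc_inc cyc_inc_monoid.

Lemma cyc_incP x : cyc_inc x \in cychat. Proof. exact: cyc_valP. Qed.

End CycField.

(** * Absence of p-th roots of p in the closure of Q(z) *)

Section NoRoot.
Variables (R : realType) (p : nat) (C : CpField R p).
Hypothesis p_gt2 : (2 < p)%N.

Local Notation v := (@vp R p C).
Local Notation "x >=v r" := ((r%:E <= v x)%E) (at level 70).
Local Notation "x =v r" := (v x = r%:E) (at level 70).
Local Notation hv := (vp_valuation C).
Local Notation "h ^C" := (map_poly (intr : int -> C) h).
Local Notation pp := (Cp_prime C).

Variables (n : nat) (z : C).
Local Notation N := (p ^ n.+1)%N.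
Hypothesis hz : N.-primitive_root z.
Local Notation w := (z ^+ (p ^ n)).

Let p0 : (0 < p)%N := prime_gt0 pp.
Let N0 : (0 < N)%N. Proof. by rewrite expn_gt0 p0. Qed.
Let zN : z ^+ N = 1 := prim_expr_order hz.
Let P2 : 3%:R <= p%:R :> R. Proof. by rewrite (ler_nat _ 3). Qed.
Let P0 : 0 < p%:R :> R. Proof. by rewrite ltr0n. Qed.

(** By [cyc_inv] the denominator can be made an integer, which conjugation does not affect. *)
Lemma cycfield_int x : x \in cycfield z -> exists h : {poly int}, exists2 m : int,
  m != 0 & x = h^C.[z] / m%:~R.
Proof.
move=> /cycfieldP[h [g ->]].
have [g0|g0] := eqVneq g^C.[z] 0.
  by exists 0, 1; rewrite // g0 rmorph0 horner0 mul0r invr0 mulr0.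
have [f [m m0 e]] := cyc_inv p_gt2 hz g0.
exists (h * f), m => //; rewrite rmorphM hornerM -e invfM.
have f0 : f^C.[z] != 0.
  by apply/eqP => f0; move: e; rewrite f0 mulr0 => /esym/eqP; rewrite intC_eq0 (negbTE m0).
by field; rewrite g0 f0.
Qed.

Lemma w_prim : p.-primitive_root w.
Proof.
have := dvdn_prim_root hz (_ : (p %| N)%N).
by rewrite expnS mulKn//; apply; rewrite dvdn_mulr.
Qed.

Lemma prim_exp c : coprime p c -> N.-primitive_root (z ^+ c).
Proof.
move=> cop; rewrite prim_root_exp_coprime//.
by rewrite coprime_sym coprimeXl.
Qed.

Lemma w_val c : coprime p c -> (w ^+ c - 1) =v (p%:R - 1)^-1.
Proof.
move=> cop; apply: prim_root_p_val => //; rewrite prim_root_exp_coprime ?w_prim//.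
by rewrite coprime_sym.
Qed.

Lemma root_p_val y : y ^+ p = p%:R -> y =v p%:R^-1.
Proof. by move=> e; rewrite -[_^-1]mul1r; apply: (veqXn hv) => //; rewrite e vp_p. Qed.

Lemma prod_w (a y : C) : y != 0 -> \prod_(k < p) (a - w ^+ k * y) = a ^+ p - y ^+ p.
Proof.
move=> y0; have := factor_Xn_sub_1 w_prim => /(congr1 (fun q => q.[a / y])).
rewrite big_mkord horner_prod !hornerE => e.
have -> : a ^+ p - y ^+ p = y ^+ p * ((a / y) ^+ p - 1).
  by rewrite mulrBr mulr1 expr_div_n mulrCA divff ?mulr1// expf_neq0.
have -> : y ^+ p = \prod_(k < p) y by rewrite prodr_const card_ord.
rewrite -e -big_split/=.
by apply: eq_bigr => k _; rewrite !hornerE mulrBr mulrCA divff// mulr1 mulrC.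
Qed.

(** If [a] is close to [y], then [a ^+ p - p] is small, and by [conj_vge] so is its conjugate. The
    latter is the product of the differences between the conjugate of [a] and the [w ^+ k * y], so
    one of these is small; the pigeonhole costs the factor [p]. *)
Lemma conj_near (h : {poly int}) (m : int) (y z' : C) B : m != 0 -> 0 <= B ->
  y ^+ p = p%:R -> N.-primitive_root z' -> (h^C.[z] / m%:~R - y) >=v B ->
  exists k : 'I_p, (h^C.[z'] / m%:~R - w ^+ k * y) >=v (B / p%:R).
Proof.
move=> m0 B0 yp hz' hB; apply: (vge_prod_factor hv) => //.
have vy := root_p_val yp.
rewrite prod_w ?(veq_neq0 hv vy)//.
have mC : m%:~R != 0 :> C by rewrite intC_eq0.
pose H := h ^+ p - (p%:Z * m ^+ p)%:P.
have HE x : H^C.[x] = (m%:~R) ^+ p * ((h^C.[x] / m%:~R) ^+ p - y ^+ p).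
  rewrite rmorphB/= rmorphXn/= map_polyC/= !hornerE yp mulrBr -exprMn [_ * (_ / _)]mulrC divfK//.
  by rewrite rmorphM rmorphXn/= [X in _ - X]mulrC.
have vm := veqX hv p (vp_int C m0).
have : H^C.[z] >=v (p%:R * (logn p `|m|)%:R + B).
  rewrite HE; apply: (vgeM hv); first by rewrite vm.
  rewrite subrXX -[B]addr0; apply: (vgeM hv) => //; apply: (vge_sum hv) => i _.
  have y0 : y >=v 0 by rewrite vy lee_fin invr_ge0 ler0n.
  have a0 : (h^C.[z] / m%:~R) >=v 0.
    by rewrite -(subrK y (_ / _)); apply: (vgeD hv) => //; apply: vgeW hB.
  have h1 := vgeX hv (p.-1 - i) a0; have h2 := vgeX hv i y0.
  by have := vgeM hv h1 h2; rewrite !mulr0 addr0.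
move=> /(conj_vge p_gt2 hz hz'); rewrite HE => hH.
rewrite -[X in v X](mulKf (expf_neq0 p mC)).
rewrite (_ : B = - (p%:R * (logn p `|m|)%:R) + (p%:R * (logn p `|m|)%:R + B)); last by ring.
by apply: (vgeM hv) => //; rewrite (veqV hv vm).
Qed.

Lemma horner_comp_Xn (h : {poly int}) c (x : C) : (h \Po 'X^c)^C.[x] = h^C.[x ^+ c].
Proof. by rewrite map_comp_poly horner_comp rmorphXn/= map_polyX hornerXn. Qed.

(** Raising to the power [N.-1] inverts the [N]-th roots of unity, so inversion is one of the
    conjugations. *)
Let Nm1 : coprime p N.-1.
Proof.
rewrite prime_coprime ?pp//; apply/negP => d1; have := dvdn_sub (_ : p %| N)%N d1.
rewrite dvdn_exp// => /(_ isT).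
by rewrite -subn1 subKn// dvdn1; lia.
Qed.

Let invE k : w ^+ k ^+ N.-1 = (w ^+ k)^-1.
Proof.
have wN : (w ^+ k) ^+ N = 1 by rewrite exprAC [w ^+ N]exprAC zN !expr1n.
have w0 : w ^+ k != 0.
  by apply/eqP => e; move: wN; rewrite e expr0n gtn_eqF//= => /esym/eqP; rewrite oner_eq0.
by apply: (mulfI w0); rewrite divff// -exprS prednK.
Qed.

Let Nm12 x : x ^+ N = 1 :> C -> (x ^+ N.-1) ^+ N.-1 = x.
Proof.
move=> xN; have x0 : x != 0.
  by apply/eqP => e; move: xN; rewrite e expr0n gtn_eqF//= => /esym/eqP; rewrite oner_eq0.
have -> : x ^+ N.-1 = x^-1 by apply: (mulfI x0); rewrite divff// -exprS prednK.
by apply: (mulIf (_ : x^-1 != 0)); rewrite ?invr_eq0// -exprSr prednK// exprVn xN invr1 divff.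
Qed.

(* Inversion on the roots of unity plays the role of complex conjugation:
   2 being invertible mod p, a p-th root of p approximated in the cyclotomic
   field can be chosen, up to a root of unity, to be approximately real. *)
Lemma real_approx (h : {poly int}) (m : int) (y : C) B : m != 0 -> 0 <= B ->
  y ^+ p = p%:R -> (h^C.[z] / m%:~R - y) >=v B ->
  exists g : {poly int}, exists2 m' : int, m' != 0 & exists2 y', y' ^+ p = p%:R &
    (g^C.[z] / m'%:~R - y') >=v (B / p%:R) /\
    forall x : C, x ^+ N = 1 -> g^C.[x ^+ N.-1] = g^C.[x].
Proof.
move=> m0 B0 yp hB; have [k hk] := conj_near m0 B0 yp (prim_exp Nm1) hB.
(* A half of [k] modulo [p]: [k] is replaced by the even number [k * p.+1], congruent to it. *)
have [j ej] : exists j, (2 * j = k * p.+1)%N.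
  exists (k * (p.+1)./2)%N; rewrite mulnCA mul2n.
  have op : odd p by have [/eqP|//] := even_prime pp; lia.
  by congr (_ * _)%N; rewrite even_halfK//= op.
have wp : w ^+ p = 1 := prim_expr_order w_prim.
have wj : w ^+ j * w ^+ j = w ^+ k.
  by rewrite -exprD addnn -mul2n ej mulnS exprD mulnC exprM wp expr1n mulr1.
have wj0 : (w ^+ j) =v 0.
  apply: (unity_root_val (n := N)) => //.
  by rewrite exprAC [w ^+ N]exprAC zN !expr1n.
pose h1 := h * 'X^(p ^ n * j).
pose g := h1 + (h1 \Po 'X^(N.-1)).
have h1E x : h1^C.[x] = h^C.[x] * x ^+ (p ^ n) ^+ j.
  by rewrite rmorphM/= hornerM rmorphXn/= map_polyX hornerXn exprM.
have C2 : (2%:~R : C) =v 0 by apply: vp_coprime => //; rewrite coprimen2; have [/eqP|//] := even_prime pp; lia.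
have m0C : (m%:~R : C) != 0 by rewrite intC_eq0.
exists g, (2 * m); first by rewrite mulf_neq0.
exists (w ^+ j * y); first by rewrite exprMn [w ^+ j ^+ p]exprAC wp expr1n mul1r.
split; last first.
  by move=> x xN; rewrite /g rmorphD/= !hornerD !horner_comp_Xn Nm12// addrC.
have C20 := veq_neq0 hv C2.
(* The new approximation is the mean of the old one times [w ^+ j] and of the inverse conjugate of
   this product; both are close to [w ^+ j * y]. *)
have -> : g^C.[z] / (2 * m)%:~R - w ^+ j * y =
  (2%:~R)^-1 * (w ^+ j * (h^C.[z] / m%:~R - y) +
    (w ^+ j)^-1 * (h^C.[z ^+ N.-1] / m%:~R - w ^+ k * y)).
  rewrite /g rmorphD/= hornerD horner_comp_Xn !h1E.
  have -> : z ^+ N.-1 ^+ (p ^ n) ^+ j = (w ^+ j)^-1.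
    by rewrite -invE -!exprM; congr (_ ^+ _); ring.
  by rewrite -wj rmorphM/=; field; rewrite m0C (veq_neq0 hv wj0) C20.
rewrite -[B / _]add0r; apply: (vgeM hv).
  by rewrite (veqV hv C2) oppr0.
apply: (vgeD hv).
  rewrite -[B / _]add0r; apply: (vgeM hv); first by rewrite wj0.
  by apply: vgeW hB; rewrite ler_pdivrMr// ler_peMr//; move: P2; lra.
by rewrite -[B / _]add0r; apply: (vgeM hv) => //; rewrite (veqV hv wj0) oppr0.
Qed.

(** The conjugate by [c] is close to some [w ^+ k * y]. Inversion fixes both [g] at [z] and [g] at
    [z ^+ c], so the conjugate is also close to [(w ^+ k)^-1 * y]. Unless [k = 0], these two differ
    by an element of valuation [1/(p-1) + 1/p], which is less than 2. *)
Lemma conj_fixed (g : {poly int}) (m : int) (y : C) B c : m != 0 -> 2 <= B ->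
  y ^+ p = p%:R -> (g^C.[z] / m%:~R - y) >=v (B * p%:R) ->
  (forall x : C, x ^+ N = 1 -> g^C.[x ^+ N.-1] = g^C.[x]) ->
  coprime p c -> (g^C.[z ^+ c] / m%:~R - y) >=v B.
Proof.
move=> m0 B2 yp hB sym cop.
have BpB : B <= B * p%:R by rewrite ler_peMr//; move: P2; lra.
have Bp0 : 0 <= B * p%:R by lra.
have [k] := conj_near m0 Bp0 yp (prim_exp cop) hB.
rewrite mulfK ?gt_eqF// => hk.
have m0C : (m%:~R : C) != 0 by rewrite intC_eq0.
have wk0 i : (w ^+ i) =v 0.
  apply: (unity_root_val (n := N)) => //.
  by rewrite exprAC [w ^+ N]exprAC zN !expr1n.
(* [G] records the closeness of the conjugate to [w ^+ k] times the original as one polynomial, so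
   that [conj_vge] can carry it from [z] to its inverse. *)
pose G := (g \Po 'X^c) - 'X^(p ^ n * k) * g.
have GE x : G^C.[x] = g^C.[x ^+ c] - x ^+ (p ^ n) ^+ k * g^C.[x].
  by rewrite rmorphB rmorphM/= hornerD hornerN hornerM horner_comp_Xn rmorphXn/= map_polyX hornerXn exprM.
have vm := vp_int C m0.
have G1 : G^C.[z] >=v (B + (logn p `|m|)%:R).
  have -> : G^C.[z] = ((g^C.[z ^+ c] / m%:~R - w ^+ k * y)
      - w ^+ k * (g^C.[z] / m%:~R - y)) * m%:~R.
    by rewrite GE; field.
  apply: (vgeM hv); last by rewrite vm.
  apply: (vgeB hv) => //; rewrite -[B]add0r; apply: (vgeM hv); first by rewrite wk0.
  exact: vgeW hB.
have G2 := conj_vge p_gt2 hz (prim_exp Nm1) G1.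
have GE2 : G^C.[z ^+ N.-1] = g^C.[z ^+ c] - (w ^+ k)^-1 * g^C.[z].
  rewrite GE sym//; congr (_ - _ * _); last by rewrite -invE -!exprM; congr (_ ^+ _); ring.
  by rewrite -exprM mulnC exprM sym// -exprM mulnC exprM zN expr1n.
have key : ((w ^+ k)^-1 * (w ^+ (k + k) - 1) * (g^C.[z] / m%:~R)) >=v B.
  have -> : (w ^+ k)^-1 * (w ^+ (k + k) - 1) * (g^C.[z] / m%:~R) =
     (G^C.[z ^+ N.-1] - G^C.[z]) * (m%:~R)^-1.
    by rewrite GE2 GE exprD; field; rewrite m0C (veq_neq0 hv (wk0 k)).
  rewrite -[B](addrK (logn p `|m|)%:R); apply: (vgeM hv); last by rewrite (veqV hv vm).
  exact: (vgeB hv).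
have vy := root_p_val yp.
have p1 : p%:R^-1 < 1 :> R by rewrite invf_lt1//; move: P2; lra.
have vg : (g^C.[z] / m%:~R) =v p%:R^-1.
  have pB : p%:R^-1 < B * p%:R by lra.
  by apply: (veq_congr hv vy _ pB); rewrite (valB hv).
case: (boolP (p %| k + k)%N) => [pk|npk].
  have k0 : (k = 0 :> nat)%N.
    move: pk; rewrite addnn -mul2n Euclid_dvdM ?pp// => /orP[/(@dvdn_leq p 2 isT)|]; first by rewrite leqNgt p_gt2.
    by move=> pk; apply/eqP; apply: contraTT pk; rewrite -lt0n => k0; rewrite gtnNdvd.
  by move: hk; rewrite k0 expr0 mul1r.
move: key; rewrite -prime_coprime ?pp// in npk.
rewrite (veqM hv (veqM hv (veqV hv (wk0 k)) (w_val npk)) vg) lee_fin oppr0 add0r => leB.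
have p2 : (p%:R - 1)^-1 < 1 :> R by rewrite invf_lt1//; move: P2; lra.
by have := le_lt_trans leB (ltrD p2 p1); rewrite ltNge B2.
Qed.

(** A root yields an approximation all of whose conjugates are close to one root [y'] of the same
    equation. Its trace is then rational and close to [p ^ n * p.-1 * y'], of valuation [n + 1/p],
    whereas nonzero rational numbers have integral valuations. *)
Lemma cychat_no_root (y : C) : y \in cychat z -> y ^+ p != p%:R.
Proof.
move=> /vclosure_predP hy; apply/eqP => yp.
(* Any precision above [n + 1/p] and at least 2 would do. The approximation starts with precision
   [B * p * p], as [real_approx] and [conj_fixed] each lose a factor [p]. *)
pose B : R := n%:R + 2.
have B2 : 2 <= B by rewrite lerDr.
have [_ /cycfield_int[h [m m0 ->]]] := hy (B * p%:R * p%:R); rewrite (valB hv) => hB.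
have [|g [m' m'0 [y' yp']]] := real_approx m0 _ yp hB; first by rewrite !mulr_ge0//; lra.
rewrite mulfK ?gt_eqF// => -[hB' sym].
have fx c (cop : coprime p c) := conj_fixed m'0 B2 yp' hB' sym cop.
have [M eM] := cyc_trace g hz.
have m0C : (m'%:~R : C) != 0 by rewrite intC_eq0.
have : (\sum_(0 <= c < N | coprime p c) (g^C.[z ^+ c] / m'%:~R - y')) >=v B.
  exact: (vge_sum hv).
rewrite big_split/= -mulr_suml eM sumrN.
have -> : \sum_(0 <= c < N | coprime p c) y' = (p ^ n)%:R * p.-1%:R * y'.
  have := sum_coprime_split (p ^ n) (fun=> y') pp; rewrite -expnS !sumr_const_nat !subn0.
  move=> /eqP; rewrite -subr_eq => /eqP <-.
  by rewrite -natrM mulr_natl -mulrnBr ?leq_pexp2l// expnS -subn1 mulnBr muln1 mulnC.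
rewrite (valB hv) => hT.
have p10 : coprime p p.-1 by rewrite coprime_sym coprimePn.
have vphi : ((p ^ n)%:R * p.-1%:R * y') =v (n%:R + 0 + p%:R^-1).
  apply: (veqM hv); last exact: root_p_val.
  apply: (veqM hv); last exact: vp_coprime.
  by rewrite vp_nat ?expn_gt0 ?p0// pfactorK ?pp.
have p1 : p%:R^-1 < 1 :> R by rewrite invf_lt1//; move: P2; lra.
have vT := veq_congr hv vphi hT (_ : _ < _).
have {vT} : (M%:~R / m'%:~R : C) =v (n%:R + 0 + p%:R^-1) by apply: vT; rewrite /B; lra.
have [->|M0] := eqVneq M 0; first by rewrite mul0r (val0 hv).
rewrite (veqM hv (vp_int C M0) (veqV hv (vp_int C m'0))) => -[] /eqP.
set a := logn _ _; set b := logn _ _; rewrite subr_eq addr0 => /eqP e.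
have : (p * a = p * (n + b) + 1)%N.
  apply/eqP; rewrite -(eqr_nat R) !natrD !natrM e natrD; apply/eqP; field.
  by rewrite gt_eqF.
by move=> /(congr1 (modn^~ p)); rewrite modnMr /= mulnC modnMDl modn_small//; lia.
Qed.

End NoRoot.

(** * Conjugation of p-power roots of p *)

Section NormEquiv.
Variables (R : realType) (p : nat) (C : CpField R p) (S : divringClosed C).
Local Notation v := (@vp R p C).
Local Notation "x >=v r" := ((r%:E <= v x)%E) (at level 70).
Local Notation hv := (vp_valuation C).
Hypothesis S_closed : forall (s : nat -> C) l, (forall n, s n \in S) -> vcvg v s l -> l \in S.

Definition free_family (x : nat -> C) d := forall a : nat -> C, (forall i, a i \in S) ->
  \sum_(i < d) a i * x i = 0 -> forall i, (i < d)%N -> a i = 0.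

Lemma free_familyW (x : nat -> C) d : free_family x d.+1 -> free_family x d.
Proof.
move=> fr a aS a0 i id.
have := fr (fun i => if (i < d)%N then a i else 0) _ _ i (leqW id); rewrite id; apply.
  by move=> j; case: ifP => _ //; exact: rpred0.
rewrite big_ord_recr/= ltnn mul0r addr0 -[RHS]a0.
by apply: eq_bigr => j _; rewrite ltn_ord.
Qed.

Lemma family_bound (x : nat -> C) d : exists E : R, forall i, (i < d)%N -> x i >=v E.
Proof.
elim: d => [|d [E hE]]; first by exists 0.
have [r hr] : exists r : R, x d >=v r.
  have [->|x0] := eqVneq (x d) 0; first by exists 0; rewrite (vge0 hv).
  by have [r hr] := veqP hv x0; exists r; rewrite hr.
exists (Num.min E r) => i; rewrite ltnS leq_eqVlt => /orP[/eqP ->|id].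
  by apply: vgeW hr; rewrite ge_min lexx orbT.
by apply: vgeW (hE i id); rewrite ge_min lexx.
Qed.

Definition coef_bounded (x : nat -> C) d := exists c : R, forall (a : nat -> C) (r : R),
  (forall i, a i \in S) -> \sum_(i < d) a i * x i >=v r ->
  forall i, (i < d)%N -> a i >=v (r - c).

(** Otherwise combinations of the earlier vectors approximate [x d] arbitrarily well; their
    coefficients are Cauchy by [coef_bounded], and the limits, which remain in [S], give a linear
    relation. *)
Lemma free_dist (x : nat -> C) d : free_family x d.+1 -> coef_bounded x d ->
  exists c' : R, forall a : nat -> C, (forall i, a i \in S) ->
    ~ (x d + \sum_(i < d) a i * x i >=v c').
Proof.
move=> fr [c hc]; apply: contrapT => /forallNP H.
have {}H (k : nat) : exists a : nat -> C, (forall i, a i \in S) /\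
    (x d + \sum_(i < d) a i * x i >=v k%:R).
  have := H k%:R => /existsNP[a] /not_implyP[aS] /contrapT ha.
  by exists a.
have [s hs] := choice H.
have sS k i : s k i \in S by have [h _] := hs k.
have sge k : x d + \sum_(i < d) s k i * x i >=v k%:R by have [_ h] := hs k.
have scau k l i : (i < d)%N -> (k <= l)%N -> s l i - s k i >=v (k%:R - c).
  move=> id kl; apply: (hc (fun i => s l i - s k i) k%:R _ _ i id).
    by move=> j; apply: rpredB.
  have -> : \sum_(j < d) (s l j - s k j) * x j =
     (x d + \sum_(j < d) s l j * x j) - (x d + \sum_(j < d) s k j * x j).
    by rewrite opprD addrACA subrr add0r -sumrB; apply: eq_bigr => j _; rewrite mulrBl.
  apply: (vgeB hv) => //; apply: vgeW (sge l); rewrite ler_nat//.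
have lim i : exists l, (i < d)%N -> vcvg v (s^~ i) l.
  case: (ltnP i d) => id; last by exists 0.
  have [l hl] : exists l, vcvg v (s^~ i) l; last by exists l.
  apply: Cp_complete => A.
  have [k hk] := Defs.nat_gt (A + c).
  exists k => a b ka kb.
  have -> : s a i - s b i = (s a i - s k i) - (s b i - s k i) by ring.
  by apply: (vgeB hv); apply: vgeW (scau _ _ _ id _) => //; lra.
have [l hl] := choice lim.
(* The limit coefficients, completed by the coefficient 1 of [x d], form the forbidden relation. *)
pose a i := if (i < d)%N then l i else if i == d then 1 else 0.
have aS i : a i \in S.
  rewrite /a; case: ltnP => id; first exact: (S_closed (s := s^~ i)) (hl i id).
  by case: eqP => _; rewrite ?rpred0 ?rpred1.
have rate k i : (i < d)%N -> l i - s k i >=v (k%:R - c).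
  move=> id; have [M hM] := hl i id (k%:R - c).
  have -> : l i - s k i = (s (maxn k M) i - s k i) - (s (maxn k M) i - l i) by ring.
  apply: (vgeB hv); last by apply: hM; rewrite leq_maxr.
  by apply: scau => //; rewrite leq_maxl.
have [E hE] := family_bound x d.
have sum0 : x d + \sum_(i < d) l i * x i = 0.
  apply: (vge_all0 hv) => r.
  have [k hk] := Defs.nat_gt (Num.max r (r + c - E)).
  have -> : x d + \sum_(i < d) l i * x i =
    (x d + \sum_(i < d) s k i * x i) + \sum_(i < d) (l i - s k i) * x i.
    by rewrite -addrA -big_split/=; congr (_ + _); apply: eq_bigr => i _; ring.
  move: hk; rewrite gt_max => /andP[k1 k2].
  apply: (vgeD hv); first by apply: vgeW (sge k); lra.
  apply: (vge_sum hv) => i _.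
  apply: vgeW (vgeM hv (rate k i (ltn_ord i)) (hE i (ltn_ord i))); lra.
have : \sum_(i < d.+1) a i * x i = 0.
  rewrite big_ord_recr/= /a ltnn eqxx mul1r addrC -[RHS]sum0.
  by congr (_ + _); apply: eq_bigr => i _; rewrite ltn_ord.
move=> /(fr a aS)/(_ d (ltnSn d)); rewrite /a ltnn eqxx => /eqP.
by rewrite oner_eq0.
Qed.

(** By induction on the dimension: [free_dist] controls the last coefficient, after which the
    induction hypothesis controls the others. *)
Lemma free_coef_bounded (x : nat -> C) d : free_family x d -> coef_bounded x d.
Proof.
elim: d => [|d ih] fr; first by exists 0.
have hb := ih (free_familyW fr); have [c hc] := hb.
have [c' hc'] := free_dist fr hb.
have [E hE] := family_bound x d.+1.
exists (`|c| + `|c'| + `|E|) => a r aS hr.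
have had : a d >=v (r - c').
  have [->|ad0] := eqVneq (a d) 0; first by rewrite (vge0 hv).
  have [t ht] := veqP hv ad0; rewrite ht lee_fin leNgt; apply/negP => tlt.
  apply: (hc' (fun i => a i / a d)); first by move=> i; apply: rpred_div.
  have -> : x d + \sum_(i < d) a i / a d * x i = (a d)^-1 * \sum_(i < d.+1) a i * x i.
    rewrite big_ord_recr/= addrC mulrDr mulKf// mulr_sumr; congr (_ + _).
    by apply: eq_bigr => i _; ring.
  by apply: vgeW (vgeM hv (_ : (- t)%:E <= _)%E hr); rewrite ?(veqV hv ht)//; lra.
have n1 := ler_norm c; have n2 := ler_norm c'; have n3 := normr_ge0 c; have n4 := normr_ge0 c'.
have n5 := normr_ge0 E; have n6 := ler_norm (- E); rewrite normrN in n6.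
move=> i; rewrite ltnS leq_eqVlt => /orP[/eqP ->|id]; first by apply: vgeW had; lra.
apply: (@vgeW _ _ _ _ (r - `|c'| - `|E| - c)); first lra.
apply: hc id => //.
have -> : \sum_(j < d) a j * x j = \sum_(j < d.+1) a j * x j - a d * x d.
  by rewrite big_ord_recr/= addrK.
apply: (vgeB hv); first by apply: vgeW hr; lra.
by apply: vgeW (vgeM hv had (hE d (ltnSn d))); lra.
Qed.

End NormEquiv.

(** * Independence of the powers of p^(1/p^n), and invariance of valuations *)

Section Spectral.
Variables (R : realType) (p : nat) (C : CpField R p).
Hypothesis p_gt2 : (2 < p)%N.

Local Notation v := (@vp R p C).
Local Notation "x >=v r" := ((r%:E <= v x)%E) (at level 70).
Local Notation "x =v r" := (v x = r%:E) (at level 70).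
Local Notation hv := (vp_valuation C).
Local Notation pp := (Cp_prime C).

Variables (n : nat) (z pi : C).
Local Notation N := (p ^ n.+1)%N.
Hypothesis hz : N.-primitive_root z.
Hypothesis hpi : pi ^+ N = p%:R.
Local Notation F := (Cychat z).
Local Notation "q ^v" := (map_poly (@cyc_inc R p C z) q) (at level 2, format "q ^v").

Let p0 : (0 < p)%N := prime_gt0 pp.
Let N0 : (0 < N)%N. Proof. by rewrite expn_gt0 p0. Qed.
Let zN : z ^+ N = 1 := prim_expr_order hz.

Let z_in : z \in cychat z.
Proof. by have := cychat_poly z 'X; rewrite map_polyX hornerX. Qed.

Let pi0 : pi != 0.
Proof.
apply/eqP => e; have := hpi; rewrite e expr0n gtn_eqF//= => e0.
by have := vp_p C; rewrite -e0 (val0 hv).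
Qed.

(** With [d = d' * p ^ e] and [d'] prime to [p], a power of [pi ^+ d] is [y ^+ d'], where [y] is a
    [p]-th root of [p]. Bezout then recovers [y] itself, against [cychat_no_root]. *)
Lemma pi_pow_notin d : (0 < d < N)%N -> pi ^+ d \notin cychat z.
Proof.
move=> /andP[d0 dN]; apply/negP => hd.
have [d' cop ed] := pfactor_coprime pp d0; set e := logn p d in ed.
have en : (e <= n)%N.
  rewrite -ltnS -(ltn_exp2l _ _ (prime_gt1 pp)); apply: leq_ltn_trans dN.
  by rewrite [X in (_ <= X)%N]ed leq_pmull//; move: d0; rewrite {1}ed muln_gt0 => /andP[].
pose y := pi ^+ (p ^ n).
have yp : y ^+ p = p%:R by rewrite -exprM -expnSr.
have yd : y ^+ d' \in cychat z.
  have -> : y ^+ d' = (pi ^+ d) ^+ (p ^ (n - e)).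
    rewrite -!exprM; congr (_ ^+ _); rewrite [X in _ = (X * _)%N]ed -mulnA -expnD subnKC//.
    by rewrite mulnC.
  exact: rpredX.
have [a _ /dvdnP[b]] := Bezoutl d' p0; rewrite (eqP cop) => eb.
have yE : y = (p%:R) ^+ b / (y ^+ d') ^+ a.
  have y0 : y != 0 by rewrite expf_neq0.
  apply: (mulIf (_ : (y ^+ d') ^+ a != 0)); first by rewrite !expf_neq0.
  by rewrite divfK ?expf_neq0// -exprM mulnC -exprS -add1n eb mulnC exprM yp.
have : y \in cychat z by rewrite [X in X \in _]yE; apply: rpred_div; apply: rpredX => //; apply: rpred_nat.
by move=> /(cychat_no_root p_gt2 hz); rewrite yp eqxx.
Qed.

Lemma conj_root a : (pi * z ^+ a) ^+ N = p%:R.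
Proof. by rewrite exprMn hpi exprAC zN expr1n mulr1. Qed.

Lemma map_XnsubC m k : ('X^m - (k%:R)%:P : {poly F})^v = 'X^m - (k%:R)%:P.
Proof. by rewrite rmorphB/= rmorphXn/= map_polyX map_polyC/= rmorph_nat. Qed.

(** The gcd of [P] and ['X^N - p] is a constant times a product of factors ['X - pi * z ^+ i]. Its
    constant coefficient lies in the closure of Q(z) and yields a power of [pi] there, with exponent
    the degree of the gcd; [pi_pow_notin] excludes this. *)
Lemma pi_poly_free (P : {poly F}) : (size P <= N)%N -> P^v.[pi] = 0 -> P = 0.
Proof.
move=> szP Ppi; apply/eqP/negPn/negP => P0.
pose Q : {poly F} := 'X^N - (p%:R)%:P.
have QE : Q^v = 'X^N - (p%:R)%:P.
  exact: map_XnsubC.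
pose D := gcdp P Q.
have D0 : D != 0 by rewrite gcdp_eq0 negb_and P0.
have Droot : root D^v pi.
  rewrite gcdp_map root_gcd; apply/andP; split; apply/rootP => //.
  by rewrite QE !hornerE hpi subrr.
have Dsz : (size D <= N)%N by apply: leq_trans szP; apply: dvdp_leq => //; apply: dvdp_gcdl.
have Qprod : Q^v = \prod_(i <- iota 0 N) ('X - (pi * z ^+ i)%:P).
  rewrite -(big_map (fun i => pi * z ^+ i) predT (fun x => 'X - x%:P)).
  rewrite [LHS](@all_roots_prod_XsubC _ _ [seq pi * z ^+ i | i <- iota 0 N]).
  - by rewrite {1}QE (eqP (monicXnsubC _ N0)) scale1r.
  - by rewrite QE size_XnsubC// size_map size_iota.
  - apply/allP => _ /mapP[i _ ->]; apply/rootP.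
    by rewrite QE !hornerE conj_root subrr.
  - rewrite uniq_rootsE map_inj_in_uniq ?iota_uniq// => i j.
    rewrite !mem_iota !add0n /= => iN jN /(mulfI pi0) /eqP.
    by rewrite (eq_prim_root_expr hz) !modn_small// => /eqP.
have : D^v %| Q^v by rewrite dvdp_map dvdp_gcdr.
rewrite Qprod => /dvdp_prod_XsubC[m].
set s := mask m _ => /eqpP[[c1 c2]/= /andP[c10 c20] e].
have szs : size D = (size s).+1.
  move: e => /(congr1 (fun q : {poly C} => size q)); rewrite !size_scale// size_map_poly.
  by rewrite size_prod_XsubC.
have [k hk] : exists k, D^v.[0] = (c1^-1 * c2) * (-1) ^+ size s * pi ^+ size s * z ^+ k.
  move: e => /(congr1 (fun q : {poly C} => c1^-1 * q.[0])); rewrite !hornerZ mulKf// => ->.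
  rewrite mulrA.
  have [k ->] : exists k, (\prod_(i <- s) ('X - (pi * z ^+ i)%:P)).[0] = (-1) ^+ size s * pi ^+ size s * z ^+ k; last by exists k; rewrite !mulrA.
  elim: s {szs} => [|i s [k ih]]; first by exists 0; rewrite big_nil hornerC !expr0 !mulr1.
  exists (i + k)%N; rewrite big_cons hornerM ih !hornerE/= !exprS exprD; ring.
have cl : c1^-1 * c2 = cyc_inc (lead_coef D).
  move: e => /(congr1 lead_coef); rewrite !lead_coefZ lead_coef_map/=.
  by rewrite (eqP (monic_prod_XsubC _ _ _)) mulr1 => <-; rewrite mulKf.
have lD : cyc_inc (lead_coef D) != 0 by rewrite fmorph_eq0 lead_coef_eq0.
have sN : (0 < size s < N)%N.
  move: Dsz; rewrite szs => ->; rewrite andbT lt0n; apply/eqP => s0.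
  have /size_poly1P[c c0 ec] : size D == 1%N by rewrite szs s0.
  by move: Droot; rewrite ec map_polyC/= rootC fmorph_eq0 (negbTE c0).
apply: (negP (pi_pow_notin sN)).
have -> : pi ^+ size s = cyc_inc (D.[0]) / cyc_inc (lead_coef D) * (-1) ^+ size s / z ^+ k.
  have -> : cyc_inc D.[0] = D^v.[0].
    by rewrite -[in RHS](rmorph0 (@cyc_inc R p C z)) horner_map.
  rewrite hk cl.
  have z0 : z != 0.
    by apply/eqP => z0; move: zN; rewrite z0 expr0n gtn_eqF//= => /esym/eqP; rewrite oner_eq0.
  have s1 : (-1 : C) ^+ size s * (-1) ^+ size s = 1 by rewrite -exprMn mulrNN mulr1 expr1n.
  have zk := expf_neq0 k z0.
  move: (cyc_inc _) ((-1 : C) ^+ _) (pi ^+ _) (z ^+ k) lD s1 zk => l sg t zk l0 s1 zk0.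
  by rewrite -[LHS]mul1r -s1; field; rewrite l0 zk0.
by rewrite rpred_div ?rpredX// rpredM ?rpredX ?rpredN ?rpred1// rpred_div// cyc_incP.
Qed.

(** Norm equivalence applied to [G ^+ k] reduced modulo ['X^N - p] bounds the coefficients, hence
    the value at the conjugate, by [k * r - c] with [c] independent of [k]. Dividing by [k] and
    letting it grow removes [c]. *)
Lemma conj_pi_vge (G : {poly F}) r a : G^v.[pi] >=v r -> G^v.[pi * z ^+ a] >=v r.
Proof.
move=> hr.
have pival : pi >=v 0.
  have : pi =v (1 / N%:R) by apply: (veqXn hv) => //; rewrite hpi vp_p.
  by move=> ->; rewrite lee_fin divr_ge0.
have tval : (pi * z ^+ a) >=v 0.
  rewrite -[0](addr0 0); apply: (vgeM hv) => //.
  by rewrite (unity_root_val N0)// exprAC zN expr1n.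
have fr : @free_family R p C (cychat z : divringClosed C) (fun i => pi ^+ i) N.
  move=> b bS b0.
  pose P : {poly F} := \poly_(i < N) (MkCychat (bS i) : F).
  have P0 : P = 0.
    apply: pi_poly_free; first exact: size_poly.
    rewrite (@horner_coef_wide _ N) ?size_map_poly ?size_poly//.
    by rewrite -[RHS]b0; apply: eq_bigr => i _; rewrite coef_map coef_poly ltn_ord.
  move=> i iN; have := congr1 (fun q : {poly F} => cyc_inc q`_i) P0.
  by rewrite coef_poly iN coef0 rmorph0.
have [c hc] := free_coef_bounded (@cychat_lim R p C z) fr.
pose Q : {poly F} := 'X^N - (p%:R)%:P.
have Q0 : Q != 0 by rewrite -size_poly_eq0 size_XnsubC.
have QE t : t ^+ N = p%:R -> Q^v.[t] = 0.
  by move=> e; rewrite map_XnsubC !hornerE e subrr.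
have main k : (G^v.[pi * z ^+ a]) ^+ k >=v (k%:R * r - c).
  pose T := (G ^+ k) %% Q.
  have TE t : t ^+ N = p%:R -> T^v.[t] = G^v.[t] ^+ k.
    move=> /QE e; rewrite -horner_exp -rmorphXn/= (divp_eq (G ^+ k) Q).
    by rewrite rmorphD rmorphM/= hornerD hornerM e mulr0 add0r.
  have szT : (size T <= N)%N.
    by rewrite -ltnS -(size_XnsubC (p%:R : F) N0) ltn_modp.
  rewrite -TE ?conj_root//; apply: (vge_horner hv) => // i.
  case: (ltnP i N) => iN; last first.
    by rewrite nth_default ?(vge0 hv)// size_map_poly (leq_trans szT).
  apply: hc iN; first by move=> j; rewrite coef_map; apply: cyc_incP.
  have := vgeX hv k hr; rewrite -TE// (@horner_coef_wide _ N)//.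
  by rewrite size_map_poly.
have [->|g0] := eqVneq (G^v.[pi * z ^+ a]) 0; first by rewrite (vge0 hv).
have [s hs] := veqP hv g0; rewrite hs lee_fin leNgt; apply/negP => sr.
have [k hk] := Defs.nat_gt (c / (r - s)).
have := main k; rewrite (veqX hv k hs) lee_fin.
move: hk; rewrite ltr_pdivrMr ?subr_gt0//; lra.
Qed.

End Spectral.

(** * The valuation of the tilt *)

Section TiltVal.
Variables (R : realType) (p : nat) (C : CpField R p).
Local Notation v := (@vp R p C).
Local Notation "x >=v r" := ((r%:E <= v x)%E) (at level 70).
Local Notation "x >=f r" := ((r%:E <= vflat x%R)%E) (at level 70).
Local Notation hv := (vp_valuation C).
Local Notation pp := (Cp_prime C).
Implicit Types (x y : tilt C).

Let p0 : (0 < p)%N := prime_gt0 pp.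
Let pX n : (0 < p ^ n)%N. Proof. by rewrite expn_gt0 p0. Qed.

Lemma vflat_vge x n r : (x >=f r) <-> x n >=v (r / (p ^ n)%:R).
Proof.
rewrite /vflat /sharp (Defs.tilt_pow x 0 n) add0n; split => [|h]; first exact: (vgeXn hv).
have := vgeX hv (p ^ n) h; rewrite mulrC divfK//.
by rewrite pnatr_eq0 -lt0n.
Qed.

Lemma vflat_veq x n r : v (x n) = r%:E -> vflat x = ((p ^ n)%:R * r)%:E.
Proof.
by move=> h; rewrite /vflat /sharp (Defs.tilt_pow x 0 n) add0n (veqX hv _ h).
Qed.

Lemma vflat_valuation : is_valuation (@vflat R p C).
Proof.
have n0 x : x != 0 -> x 0%N != 0 by exact: tilt_neq0.
have D0 x y r : (x >=f r) -> (y >=f r) -> ((x + y) >=f r).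
  move=> hx hy; apply: (vge_lim hv (tilt_addE x y 0)) => k; rewrite add0n.
  have k0 : (p ^ k)%:R != 0 :> R by rewrite pnatr_eq0 -lt0n.
  have -> : r = (p ^ k)%:R * (r / (p ^ k)%:R) by rewrite mulrC divfK.
  by apply: (vgeX hv); apply: (vgeD hv); apply/vflat_vge.
split.
- move=> x; rewrite /vflat /sharp vp_eqy; apply/eqP/eqP => [x0|-> //].
  by apply/eqP; apply: contraT => /n0; rewrite x0 eqxx.
- by move=> x /n0; apply: vp_fin.
- by move=> x y; rewrite /vflat /sharp tilt_mulE vpM.
- move=> x y; have [->|x0] := eqVneq x 0; first by rewrite add0r ge_min lexx orbT.
  have [->|y0] := eqVneq y 0; first by rewrite addr0 ge_min lexx.
  have /fineK ex := vp_fin (n0 _ x0); have /fineK ey := vp_fin (n0 _ y0).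
  rewrite {1 2}/vflat /sharp -ex -ey -EFin_min; apply: D0.
    by rewrite /vflat /sharp -ex lee_fin ge_min lexx.
  by rewrite /vflat /sharp -ey lee_fin ge_min lexx orbT.
Qed.

Local Notation hf := vflat_valuation.

(* Modulo p, the components of integral elements of the tilt add up. *)
Definition comp_congr n x (a : C) := (x >=f 0) /\ x n - a >=v 1.

Lemma vflat_ge0 x n : (x >=f 0) -> x n >=v 0.
Proof. by move=> /(vflat_vge x n); rewrite mul0r. Qed.

Lemma comp_congr_vge0 n x a : comp_congr n x a -> a >=v 0.
Proof.
move=> [/(vflat_ge0 n) h1 h2]; apply: (vge_congr hv h1 _ (lexx _)).
exact: vgeW h2.
Qed.

Lemma comp_congrD n x y a b : comp_congr n x a -> comp_congr n y b ->
  comp_congr n (x + y) (a + b).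
Proof.
move=> [x0 xa] [y0 yb]; split; first exact: (vgeD hf).
have h : (x + y) n - (x n + y n) >=v 1.
  (* For integral components the error bound [B] is 0, so already the first term of the limit
     defining [(x + y) n] is correct modulo [p]. *)
  have ac : Defs.ac_ (fun m => x m + y m) 0.
    split=> m; rewrite mul0r ?oppr0 ?subr0.
      by apply: (vgeD hv); apply: vflat_ge0.
    rewrite -(tseqP x m) -(tseqP y m) opprD addrA.
    have := @Defs.frob R p C (x m.+1) (y m.+1) 0 0 (lexx _).
    rewrite mulr0 oppr0 !addr0; apply; exact: vflat_ge0.
  have [_ /(_ 0%N)] := Defs.tlim_cvg n ac.
  by rewrite addn0 expn0 expr1 mul0r subr0 addr0.
have -> : (x + y) n - (a + b) = ((x + y) n - (x n + y n)) + ((x n - a) + (y n - b)).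
  by ring.
by do 2 ?[apply: (vgeD hv) => //].
Qed.

Lemma comp_congrM n x y a b : comp_congr n x a -> comp_congr n y b ->
  comp_congr n (x * y) (a * b).
Proof.
move=> hxa hyb; have [x0 xa] := hxa; have [y0 yb] := hyb; split.
  by have := vgeM hf x0 y0; rewrite addr0.
rewrite tilt_mulE.
have -> : x n * y n - a * b = (x n - a) * y n + a * (y n - b) by ring.
apply: (vgeD hv).
  by rewrite -[X in (X%:E <= _)%E]addr0; apply: (vgeM hv) => //; apply: vflat_ge0.
rewrite -[X in (X%:E <= _)%E]add0r; apply: (vgeM hv) => //.
exact: comp_congr_vge0 hxa.
Qed.

Lemma comp_congr0 n : comp_congr n 0 0.
Proof. by split; [exact: (vge0 hf)|rewrite subr0; exact: (vge0 hv)]. Qed.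

Lemma comp_congr1 n : comp_congr n 1 1.
Proof. by split; [exact: (vge1 hf)|rewrite subrr; exact: (vge0 hv)]. Qed.

Lemma comp_congrN n x a : comp_congr n x a -> comp_congr n (- x) (- a).
Proof.
move=> [x0 xa]; split; first by rewrite (valN hf).
have Nx0 : ((- x) >=f 0) by rewrite (valN hf).
have refl y : (y >=f 0) -> comp_congr n y (y n).
  by move=> y0; split=> //; rewrite subrr; exact: (vge0 hv).
have [_] := comp_congrD (refl _ x0) (refl _ Nx0); rewrite subrr => h.
have -> : (- x) n - - a = - ((0 : tilt C) n - (x n + (- x) n)) - (x n - a) by rewrite /=; ring.
by apply: (vgeB hv) => //; rewrite (valN hv).
Qed.

Lemma comp_congr_nat n k : comp_congr n k%:R k%:R.
Proof.
elim: k => [|k ih]; first exact: comp_congr0.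
by rewrite -!natr1; apply: comp_congrD ih (comp_congr1 n).
Qed.

Lemma comp_congrX n x a k : comp_congr n x a -> comp_congr n (x ^+ k) (a ^+ k).
Proof.
move=> h; elim: k => [|k ih]; first exact: comp_congr1.
by rewrite !exprS; apply: comp_congrM.
Qed.

Lemma comp_congr_sum n k (f : 'I_k -> tilt C) (g : 'I_k -> C) :
  (forall i, comp_congr n (f i) (g i)) ->
  comp_congr n (\sum_(i < k) f i) (\sum_(i < k) g i).
Proof.
move=> h; elim/big_ind2 : _ => //; first exact: comp_congr0.
by move=> ? ? ? ?; apply: comp_congrD.
Qed.

(** The [n]-th component divides valuations by [p ^ n], so a bound up to [p ^ n] in the tilt becomes
    a bound up to 1, visible modulo [p]. *)
Lemma comp_congr_vge n x a s : s <= (p ^ n)%:R -> comp_congr n x a ->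
  ((x >=f s) <-> a >=v (s / (p ^ n)%:R)).
Proof.
move=> sn [x0 xa].
have le1 : s / (p ^ n)%:R <= 1 by rewrite ler_pdivrMr ?mul1r// ltr0n.
split=> [/(vflat_vge x n) h|h]; first exact: (vge_congr hv h xa).
by apply/(vflat_vge x n); apply: (vge_congr hv h _ le1); rewrite (valB hv).
Qed.

End TiltVal.

(** * Invariance of the valuation of f(u, eta) under u -> u * eps^a *)

Section Transfer.
Variables (R : realType) (p : nat) (C : CpField R p).
Hypothesis p_gt2 : (2 < p)%N.
Variables (u eps : tilt C).
Hypothesis u_sharp : sharp u = p%:R.
Hypothesis eps_prim : forall n : nat, (p ^ n).-primitive_root (eps n).
Local Notation v := (@vp R p C).
Local Notation "x >=v r" := ((r%:E <= v x)%E) (at level 70).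
Local Notation "x >=f r" := ((r%:E <= vflat x%R)%E) (at level 70).
Local Notation hv := (vp_valuation C).
Local Notation hf := (vflat_valuation C).
Local Notation pp := (Cp_prime C).
Local Notation eta := (eps - 1).
Local Notation "h ^C" := (map_poly (intr : int -> C) h).

Let p0 : (0 < p)%N := prime_gt0 pp.
Let pX n : (0 < p ^ n)%N. Proof. by rewrite expn_gt0 p0. Qed.

Lemma vflat_eps : vflat eps = 0%:E.
Proof.
by rewrite /vflat /sharp -[eps 0%N]expr1 -(expn0 p) (prim_expr_order (eps_prim 0)) (veq1 hv).
Qed.

Lemma vflat_u : vflat u = 1%:E.
Proof. by rewrite /vflat u_sharp vp_p. Qed.

Lemma comp_congr_id n (x : tilt C) : (x >=f 0) -> comp_congr n x (x n).
Proof. by move=> h; split=> //; rewrite subrr (vge0 hv). Qed.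

Lemma comp_congr_eta n : comp_congr n eta (eps n - 1).
Proof.
apply: comp_congrD; first by apply: comp_congr_id; rewrite vflat_eps.
exact: comp_congrN (comp_congr1 C n).
Qed.

(** The component of index 1 suffices: modulo [p] it is [eps 1 - 1], whose valuation [1/(p-1)] is
    below 1. *)
Lemma vflat_eta : vflat eta = (p%:R / (p%:R - 1))%:E.
Proof.
have P3 : 3 <= p%:R :> R by rewrite (ler_nat _ 3).
have [_ h] := comp_congr_eta 1.
have e1 : p.-primitive_root (eps 1%N) by have := eps_prim 1; rewrite expn1.
have h1 := prim_root_p_val p_gt2 e1.
have lt1 : (p%:R - 1)^-1 < 1 :> R by rewrite invf_lt1; move: P3; lra.
rewrite (valB hv) in h; have := vflat_veq (veq_congr hv h1 h lt1).
by rewrite expn1.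
Qed.

(** As soon as [p ^ n.+1] exceeds [s], the bound can be tested modulo [p] on the component [n.+1].
    There the two sums become the values of one polynomial at [pi] and at [pi * z ^+ a]. *)
Lemma partial_sum_conj (F : nat -> nat -> 'F_p) M a s :
  ((partial_sum u eta F M) >=f s) ->
  ((partial_sum (u * eps ^+ a) eta F M) >=f s).
Proof.
have [k hk] := Defs.nat_gt s; pose n := k.
have sn : s <= (p ^ n.+1)%:R.
  apply: le_trans (ltW hk) _; rewrite ler_nat.
  by apply: leq_trans (ltnW (ltn_expl k (prime_gt1 pp))) _; rewrite leq_exp2l// prime_gt1// pp.
pose z := eps n.+1; pose pi := u n.+1.
have hz : (p ^ n.+1).-primitive_root z := eps_prim n.+1.
have hpi : pi ^+ (p ^ n.+1) = p%:R by rewrite -u_sharp /sharp (Defs.tilt_pow u 0 n.+1) add0n.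
(* A lift of the coefficient of [u ^+ i]: residues become their integer representatives and [eta]
   becomes [z - 1]. *)
pose h i : {poly int} := \sum_(j < M.+1) (F i j : nat)%:R * ('X - 1) ^+ j.
have hE i : (h i)^C.[z] = \sum_(j < M.+1) (F i j : nat)%:R * (z - 1) ^+ j.
  rewrite rmorph_sum/= horner_sum; apply: eq_bigr => j _.
  by rewrite rmorphM rmorphXn rmorphB/= rmorph_nat map_polyX rmorph1 hornerM horner_exp !hornerE -polyC_natr hornerC.
pose G : {poly Cychat z} := \poly_(i < M.+1) MkCychat (cychat_poly z (h i)).
have GE t : (map_poly (@cyc_inc R p C z) G).[t] =
    \sum_(i < M.+1) \sum_(j < M.+1) (F i j : nat)%:R * t ^+ i * (z - 1) ^+ j.
  rewrite (@horner_coef_wide _ M.+1) ?size_map_poly ?size_poly//.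
  apply: eq_bigr => i _; rewrite coef_map/= coef_poly ltn_ord [cyc_inc _]hE mulr_suml.
  by apply: eq_bigr => j _; ring.
have cg (x : tilt C) : (x >=f 0) ->
    comp_congr n.+1 (partial_sum x eta F M) (map_poly (@cyc_inc R p C z) G).[x n.+1].
  move=> x0; rewrite GE; apply: comp_congr_sum => i; apply: comp_congr_sum => j.
  apply: comp_congrM (comp_congrX _ (comp_congr_eta _)).
  by apply: comp_congrM (comp_congr_nat _ _ _) (comp_congrX _ (comp_congr_id _ x0)).
have u0 : (u >=f 0) by rewrite vflat_u lee_fin.
have ue0 : ((u * eps ^+ a) >=f 0).
  by rewrite (veqM hf vflat_u (veqX hf a vflat_eps)) lee_fin mulr0 addr0.
move=> /(comp_congr_vge sn (cg u u0)) hG.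
apply/(comp_congr_vge sn (cg _ ue0)).
have -> : (u * eps ^+ a) n.+1 = pi * z ^+ a.
  rewrite tilt_mulE; congr (_ * _); elim: a {ue0} => [//|a ih].
  by rewrite !exprS tilt_mulE ih.
exact: (conj_pi_vge p_gt2 hz hpi).
Qed.

End Transfer.

(** * Elimination by q-differences *)

Section MainBound.
Variables (R : realType) (p : nat) (C : CpField R p).
Hypothesis p_gt2 : (2 < p)%N.
Variables (u eps : tilt C).
Hypothesis u_sharp : sharp u = p%:R.
Hypothesis eps_prim : forall n : nat, (p ^ n).-primitive_root (eps n).
Local Notation v := (@vflat R p C).
Local Notation "x >=v r" := ((r%:E <= v x%R)%E) (at level 70).
Local Notation "x =v r" := (v x%R = r%:E) (at level 70).
Local Notation hv := (vflat_valuation C).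
Local Notation pp := (Cp_prime C).
Local Notation eta := (eps - 1).
Local Notation e0 := ((p%:R / (p%:R - 1)) : R).

Let P3 : 3 <= p%:R :> R. Proof. by rewrite (ler_nat _ 3). Qed.

Let e0_gt0 : 0 < e0.
Proof. by apply: divr_gt0; move: P3; lra. Qed.

(** For [d = m * p ^ k] with [m] prime to [p], [eps ^+ d - 1] is the [p ^ k]-th power of
    [eps ^+ m - 1] in characteristic [p], and [eps ^+ m] is again a compatible system of primitive
    roots. *)
Lemma vflat_epsX d : (0 < d)%N -> exists2 r, r <= d%:R * e0 & (eps ^+ d - 1) =v r.
Proof.
move=> d0; have [m cop ed] := pfactor_coprime pp d0; set k := logn p d in ed.
have epsm n : (p ^ n).-primitive_root ((eps ^+ m) n).
  have -> : (eps ^+ m) n = eps n ^+ m.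
    by elim: m {cop ed} => [//|m ih]; rewrite !exprS tilt_mulE ih.
  by rewrite prim_root_exp_coprime// coprime_sym coprimeXl.
have h := vflat_eta p_gt2 epsm.
have e : eps ^+ d - 1 = (eps ^+ m - 1) ^+ (p ^ k).
  have pn : [pchar (tilt C)].-nat (p ^ k)%N.
    by rewrite pnatX pnatE ?pp// pchar_tilt.
  by rewrite [in RHS]exprDn_pchar// exprNn_pchar// expr1n -exprM -ed.
exists ((p ^ k)%:R * e0); last by rewrite e (veqX hv _ h).
rewrite ler_pM2r// ler_nat [X in (_ <= X)%N]ed leq_pmull//.
by move: d0; rewrite {1}ed muln_gt0 => /andP[].
Qed.

(** Fermat: [c ^+ p = c] forces the valuation to be 0. *)
Lemma vflat_Fp (c : 'F_p) : c != 0 -> ((c : nat)%:R : tilt C) =v 0.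
Proof.
move=> c0.
have n0 : (c : nat)%:R != 0 :> tilt C.
  rewrite -(dvdn_pcharf (pchar_tilt C)).
  have cp : (c < p)%N by rewrite -[X in (_ < X)%N](Fp_cast pp) ltn_ord.
  by rewrite gtnNdvd// lt0n; apply: contra c0 => /eqP c0; apply/eqP/val_inj.
have [r hr] := veqP hv n0.
have : ((c : nat)%:R : tilt C) ^+ p = (c : nat)%:R.
  by rewrite -(pFrobenius_autE (pchar_tilt C)) rmorph_nat.
move=> /(congr1 v); rewrite (veqX hv p hr) hr => -[e]; congr EFin.
have : (p%:R - 1) * r = 0 by rewrite mulrBl mul1r e subrr.
by move=> /eqP; rewrite mulf_eq0 => /orP[/eqP|/eqP //]; move: P3; lra.
Qed.

(** The factor by which [m] successive q-differences multiply a monomial of degree [i] in [u]. *)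
Definition qprod (i m : nat) : tilt C := \prod_(l < m) (eps ^+ i - eps ^+ l).

Lemma qprodS i m : qprod i.+1 m.+1 = (eps ^+ i.+1 - 1) * eps ^+ m * qprod i m.
Proof.
rewrite /qprod big_ord_recl expr0 -mulrA; congr (_ * _).
have -> : eps ^+ m = \prod_(l < m) eps by rewrite prodr_const card_ord.
rewrite -big_split/=.
by apply: eq_bigr => l _; rewrite /bump leq0n add1n !exprS mulrBr.
Qed.

Lemma qprod_small i m : (i < m)%N -> qprod i m = 0.
Proof.
by move=> im; rewrite /qprod (bigD1 (Ordinal im))//= subrr mul0r.
Qed.

(* The quotient of qprod i m by qprod m m is, up to a power of eps, a Gaussian
   binomial coefficient at q = eps, hence integral. *)
Lemma qprod_vge m : exists B : R, [/\ B <= e0 * (m%:R ^+ 2), qprod m m =v B &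
  forall i, qprod i m >=v B].
Proof.
elim: m => [|m [B [Ble hB ih]]].
  by exists 0; split; rewrite ?expr2 ?mulr0 /qprod ?big_ord0 ?(veq1 hv)// => i; rewrite big_ord0 (veq1 hv).
have [r rle hr] := vflat_epsX (ltn0Sn m).
have he := vflat_eps eps_prim.
have hm := veqX hv m he; rewrite mulr0 in hm.
have hB' : qprod m.+1 m.+1 =v (r + 0 + B).
  by rewrite qprodS; apply: (veqM hv) => //; apply: (veqM hv).
exists (r + 0 + B); split => //.
  (* The valuation grows by at most [(m + 1) * e0], the bound by [(2 * m + 1) * e0]. *)
  have := mulr_ge0 (ltW e0_gt0) (ler0n R m); move: rle Ble; rewrite -natr1 addr0.
  by move: e0 (m%:R : R) => e m'; nra.
elim=> [|i ihi]; first by rewrite qprod_small// (vge0 hv).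
(* The Pascal recursion of Gaussian binomials, cleared of denominators. *)
have -> : qprod i.+1 m.+1 = eps ^+ m.+1 * qprod i m.+1 + (eps ^+ m.+1 - 1) * eps ^+ m * qprod i m.
  by rewrite qprodS {2}/qprod big_ord_recr/= -/(qprod i m) !exprS; ring.
apply: (vgeD hv).
  rewrite -[X in (X%:E <= _)%E]add0r; apply: (vgeM hv) => //.
  by rewrite (veqX hv m.+1 he) mulr0.
by apply: (vgeM hv) => //; rewrite (veqM hv hr hm).
Qed.

Section Poly.
Variables (F : nat -> nat -> 'F_p) (M : nat) (s : R).
Hypothesis hs : partial_sum u eta F M >=v s.

(** The closed form of W_k(a); [qdiffS] is the defining recursion. *)
Definition qdiff (k a : nat) : tilt C := \sum_(i < M.+1) \sum_(j < M.+1)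
  (F i j : nat)%:R * u ^+ i * eta ^+ j * eps ^+ (a * i) * qprod i k.

Lemma qdiffS k a : qdiff k.+1 a = qdiff k a.+1 - eps ^+ k * qdiff k a.
Proof.
rewrite /qdiff mulr_sumr -sumrB; apply: eq_bigr => i _.
rewrite mulr_sumr -sumrB; apply: eq_bigr => j _.
by rewrite /qprod big_ord_recr/= mulSn exprD; ring.
Qed.

Lemma qdiff_vge k a : qdiff k a >=v s.
Proof.
elim: k a => [|k ih] a.
  have := partial_sum_conj p_gt2 u_sharp eps_prim a hs.
  congr (_ <= v _)%E; rewrite /partial_sum /qdiff; apply: eq_bigr => i _.
  apply: eq_bigr => j _; rewrite /qprod big_ord0 mulr1 exprMn exprM; ring.
rewrite qdiffS; apply: (vgeB hv) => //; rewrite -[s]add0r; apply: (vgeM hv) => //.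
by rewrite (veqX hv k (vflat_eps eps_prim)) mulr0.
Qed.

(** In [qdiff i0 0] the monomial [(i0, j0)] has valuation [t + B], and every other one vanishes or
    has a larger valuation: [hlt] treats [i > i0], and for [i = i0] distinct [j] give distinct
    values. *)
Lemma partial_sum_bound (i0 j0 : nat) : (i0 <= M)%N -> (j0 <= M)%N -> F i0 j0 != 0 ->
  (forall i j, F i j != 0 -> i0%:R + j0%:R * e0 <= i%:R + j%:R * e0) ->
  (forall i j, F i j != 0 -> (i0 < i)%N -> i0%:R + j0%:R * e0 < i%:R + j%:R * e0) ->
  s <= i0%:R + j0%:R * e0 + e0 * (i0%:R ^+ 2).
Proof.
move=> iM jM F0 hmin hlt.
have [B [Ble hB hBi]] := qprod_vge i0.
have := qdiff_vge i0 0; rewrite /qdiff pair_big/=.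
set t := i0%:R + j0%:R * e0 in hmin hlt *.
have vmon i j : F i j != 0 ->
    ((F i j : nat)%:R * u ^+ i * eta ^+ j * eps ^+ (0 * i)) =v (i%:R + j%:R * e0).
  move=> Fij; rewrite mul0n expr0 mulr1.
  rewrite (veqM hv (veqM hv (vflat_Fp Fij) (veqX hv i (vflat_u u_sharp)))
    (veqX hv j (vflat_eta p_gt2 eps_prim))).
  by rewrite add0r mulr1.
rewrite (_ : \sum_(_ | _) _ =v (t + B)).
  by rewrite lee_fin => h; apply: le_trans h _; rewrite lerD2l.
pose ij0 : 'I_M.+1 * 'I_M.+1 := (Ordinal (iM : i0 < M.+1)%N, Ordinal (jM : j0 < M.+1)%N).
apply: (veq_sum hv (i0 := ij0)) => /=; first exact: (veqM hv (vmon _ _ F0) hB).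
move=> [i j]; rewrite /ij0 xpair_eqE /= => ne.
have [Fij|Fij] := eqVneq (F i j) 0.
  by rewrite Fij mulr0n !mul0r (val0 hv) ltry.
case: (ltnP i i0) => ii0; first by rewrite (qprod_small ii0) mulr0 (val0 hv) ltry.
suff tlt : t < i%:R + j%:R * e0.
  apply: (@lt_le_trans _ _ ((i%:R + j%:R * e0) + B)%:E); first by rewrite lte_fin ltrD2r.
  by apply: (vgeM hv) => //; rewrite vmon.
move: ii0; rewrite leq_eqVlt => /orP[/eqP ei|]; last exact: hlt.
rewrite lt_neqAle hmin// andbT; apply: contra ne => /eqP.
rewrite /t -ei => /addrI /(mulIf _) e.
have ej : j0 = j.
  by apply/eqP; rewrite -(eqr_nat R); apply/eqP/e; rewrite gt_eqF.
by apply/andP; split; apply/eqP/val_inj.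
Qed.

End Poly.
End MainBound.

(** * The valuation bounds *)

Section FrakM.
Variables (R : realType) (p : nat).
Hypothesis p_gt2 : (2 < p)%N.

(** For [p] invertible this is the product of the [p * k + p + 1] over [k < m]; its square carries
    the main term of M. The field varies because M is rational while the Gamma estimate is real. *)
Definition frakQ (F : fieldType) (m : nat) : F :=
  p%:R ^+ m * \prod_(0 <= k < m) (k%:R + (p%:R + 1) / p%:R).

Let P3 : 3 <= p%:R :> rat. Proof. by rewrite (ler_nat _ 3). Qed.

Lemma frakQS m : frakQ rat m.+1 = (p%:R * m%:R + p%:R + 1) * frakQ rat m.
Proof.
rewrite /frakQ big_nat_recr//= exprS; set A := \prod_(_ <= _ < _) _.
by field; rewrite gt_eqF//; move: P3; lra.
Qed.

Lemma frakQ_ge1 m : 1 <= frakQ rat m.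
Proof.
elim: m => [|m ih]; first by rewrite /frakQ big_geq// mulr1 expr0.
rewrite frakQS; have : 0 <= (p%:R * m%:R + p%:R) * frakQ rat m.
  by apply: mulr_ge0; [rewrite addr_ge0// mulr_ge0|apply: le_trans ih].
by move: ih; lra.
Qed.

(** The sum subtracted in M lies between 0 and [frakQ]: its terms are [(p-1) * (m+1) * frakQ m], at
    most the increments [p * (m+1) * frakQ m] of [frakQ]. *)
Lemma frakM_bounds (t : R) : let Q := frakQ rat (`|Num.ceil t|%N.+1) in
  p%:R / (p%:R - 1) * Q ^+ 2 - Q <= frakM p t <= p%:R / (p%:R - 1) * Q ^+ 2.
Proof.
rewrite /frakM; set n := `|_|%N; move: n => n.
pose T m : rat := \sum_(0 <= k < m) (k%:R + 1) * p%:R ^+ k *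
  \prod_(0 <= l < k) (l%:R + (p%:R + 1) / p%:R).
have TS m : T m.+1 = T m + (m%:R + 1) * frakQ rat m.
  by rewrite /T big_nat_recr//= -mulrA.
have T0 m : 0 <= T m.
  elim: m => [|m ih]; first by rewrite /T big_geq.
  rewrite TS addr_ge0// mulr_ge0// ?addr_ge0//; exact: le_trans (frakQ_ge1 m).
have TQ m : (p%:R - 1) * T m <= frakQ rat m.
  elim: m => [|m ih]; first by rewrite /T big_geq// mulr0 (le_trans _ (frakQ_ge1 0)).
  rewrite TS frakQS mulrDr.
  have : 0 <= (m%:R + 1) * frakQ rat m.
    by rewrite mulr_ge0 ?addr_ge0//; exact: le_trans (frakQ_ge1 m).
  by move: ih; lra.
rewrite -/(T n.+1).
have -> : p%:R ^+ (2 * n + 3) / (p%:R - 1) *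
    \prod_(0 <= k < n.+1) (k%:R + (p%:R + 1) / p%:R) ^+ 2 =
    p%:R / (p%:R - 1) * frakQ rat n.+1 ^+ 2 :> rat.
  rewrite prodrXl /frakQ (_ : 2 * n + 3 = (n.+1 + n.+1).+1)%N; last lia.
  set A := \prod_(_ <= _ < _) _.
  by rewrite exprS exprD; field; rewrite gt_eqF//; move: P3; lra.
have := TQ n.+1; have : 0 <= (p%:R - 1) * T n.+1.
  by apply: mulr_ge0 => //; move: P3; lra.
by move=> ? ?; apply/andP; split; lra.
Qed.

(** Both [t] and [i] are at most the ceiling [n] of [t], on which M depends, and it is enough that
    [frakQ] at [n.+1] is at least [n + 2]. *)
Lemma bound_lt_frakM (t : R) (i : nat) : i%:R <= t ->
  t + p%:R / (p%:R - 1) * i%:R ^+ 2 < ratr (frakM p t).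
Proof.
move=> it; have t0 : 0 <= t := le_trans (ler0n R i) it.
have /andP[h _] := frakM_bounds t; move: h; set n := `|_|%N; set M := frakM p t => h.
have tn : t <= n%:R.
  have c0 : 0 <= Num.ceil t by rewrite -(ceil0 R) ceil_le.
  have -> : n%:R = (Num.ceil t)%:~R :> R by rewrite /n -[in RHS](gez0_abs c0).
  exact: ceil_ge.
have i_n : (i <= n)%N by rewrite -(ler_nat R) (le_trans it).
have P3R : 3 <= p%:R :> R by rewrite (ler_nat _ 3).
have : n%:R + p%:R / (p%:R - 1) * n%:R ^+ 2 < M.
  apply: lt_le_trans h.
  have e1 : 1 <= p%:R / (p%:R - 1) :> rat by rewrite ler_pdivlMr; move: P3; lra.
  have Qn : n%:R + 2 <= frakQ rat n.+1.
    rewrite frakQS; apply: le_trans (_ : p%:R * n%:R + p%:R + 1 <= _).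
      have : 3 * n%:R <= p%:R * n%:R :> rat by rewrite ler_wpM2r.
      by have := ler0n rat n; move: P3; lra.
    by rewrite ler_peMr ?frakQ_ge1// !addr_ge0// mulr_ge0.
  have n0 := ler0n rat n.
  move: (p%:R / _) (frakQ _ _) (n%:R : rat) e1 Qn n0 => e Q x e1 Qn n0.
  have h1 : (x + 2) * (x + 1) <= Q * (Q - 1) by apply: ler_pM; lra.
  have h2 : e * ((x + 2) * (x + 1)) <= e * (Q * (Q - 1)) by rewrite ler_pM2l//; lra.
  have h3 : 0 <= (e - 1) * Q by apply: mulr_ge0; lra.
  have h4 : 0 <= (e - 1) * x by apply: mulr_ge0; lra.
  by lra.
rewrite -(ltr_rat R) => /(le_lt_trans _); apply.
rewrite rmorphD rmorphM/= fmorph_div rmorphB rmorphXn/= !ratr_nat rmorph1.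
apply: lerD => //; rewrite ler_wpM2l//; first by apply: divr_ge0; move: P3R; lra.
by rewrite ler_pXn2r ?nnegrE ?ler0n// ler_nat.
Qed.

End FrakM.

(** * The inequalities between the two valuations *)

Section FirstPart.
Variables (R : realType) (p : nat) (C : CpField R p).
Hypothesis p_gt2 : (2 < p)%N.
Variables (u eps : tilt C).
Hypothesis u_sharp : sharp u = p%:R.
Hypothesis eps_prim : forall n : nat, (p ^ n).-primitive_root (eps n).
Local Notation v := (@vflat R p C).
Local Notation hv := (vflat_valuation C).
Local Notation eta := (eps - 1).
Local Notation e0 := ((p%:R / (p%:R - 1)) : R).

Let P3 : 3 <= p%:R :> R. Proof. by rewrite (ler_nat _ 3). Qed.
Let e0_gt0 : 0 < e0. Proof. by apply: divr_gt0; move: P3; lra. Qed.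

Lemma expansion_neq0 (F : nat -> nat -> 'F_p) (f : tilt C) : is_expansion u eta F f ->
  f != 0 -> exists i j, F i j != 0.
Proof.
move=> hF; apply: contra_neqP => /forallNP F0; apply: (vge_all0 hv) => r.
have [M hM] := hF r; have := hM M (leqnn M).
rewrite [partial_sum _ _ _ _](_ : _ = 0) ?sub0r ?(valN hv)//.
apply: big1 => i _; apply: big1 => j _.
have -> : F i j = 0 by apply/eqP/negPn/negP => h; apply: (F0 i); exists j.
by rewrite mulr0n !mul0r.
Qed.

(* Values of monomials, multiplied by p - 1. *)
Let wt (i j : nat) := (i * p.-1 + j * p)%N.

Let wtE i j : i%:R + j%:R * e0 = (wt i j)%:R / (p%:R - 1).
Proof.
have -> : (wt i j)%:R = i%:R * (p%:R - 1) + j%:R * p%:R :> R.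
  by rewrite /wt natrD !natrM -subn1 natrB//; lia.
by field; rewrite gt_eqF//; move: P3; lra.
Qed.

Let wt_lt i j i' j' : (i%:R + j%:R * e0 < i'%:R + j'%:R * e0) = (wt i j < wt i' j')%N.
Proof. by rewrite !wtE ltr_pM2r ?ltr_nat// invr_gt0; move: P3; lra. Qed.

Let wt_le i j i' j' : (i%:R + j%:R * e0 <= i'%:R + j'%:R * e0) = (wt i j <= wt i' j')%N.
Proof. by rewrite leNgt wt_lt [RHS]leqNgt. Qed.

Lemma min_monomial (F : nat -> nat -> 'F_p) : (exists i j, F i j != 0) ->
  exists i0 j0, [/\ F i0 j0 != 0,
    forall i j, F i j != 0 -> i0%:R + j0%:R * e0 <= i%:R + j%:R * e0 &
    forall i j, F i j != 0 -> (i0 < i)%N -> i0%:R + j0%:R * e0 < i%:R + j%:R * e0].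
Proof.
move=> [i [j Fij]].
have exw : exists w, `[< exists i j, F i j != 0 /\ wt i j = w >].
  by exists (wt i j); apply/asboolP; exists i, j.
case: (ex_minnP exw) => w /asboolP[i1 [j1 [F1 e1]]] wmin.
have exi : exists i, `[< exists j, F i j != 0 /\ wt i j = w >].
  by exists i1; apply/asboolP; exists j1.
have bnd i' : `[< exists j, F i' j != 0 /\ wt i' j = w >] -> (i' <= w)%N.
  move=> /asboolP[j' [_ <-]]; apply: leq_trans (leq_addr _ _).
  by rewrite leq_pmulr//; lia.
case: (ex_maxnP exi bnd) => i0 /asboolP[j0 [F0 e]] imax.
have le i' j' : F i' j' != 0 -> (wt i0 j0 <= wt i' j')%N.
  by move=> F'; rewrite e; apply: wmin; apply/asboolP; exists i', j'.
exists i0, j0; split => // i' j' F'; first by rewrite wt_le le.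
move=> ii; rewrite wt_lt ltn_neqAle le// andbT; apply/eqP => ew.
suff : (i' <= i0)%N by rewrite leqNgt ii.
by apply: imax; apply/asboolP; exists j'; split=> //; rewrite -ew.
Qed.

Lemma vflat_bounds (f : tilt C) : Enp_plus u eta f -> f != 0 ->
  (vmono u eta f <= v f)%E /\ (v f < (ratr (frakM p (fine (vmono u eta f))))%:E)%E.
Proof.
move=> hf f0; set F := coefs u eta f.
have hF : is_expansion u eta F f by exact: xgetPex hf.
have [i0 [j0 [F0 hmin hlt]]] := min_monomial (expansion_neq0 hF f0).
have vu := vflat_u u_sharp; have ve := vflat_eta p_gt2 eps_prim.
set t := i0%:R + j0%:R * e0 in hmin hlt.
have tE : vmono u eta f = t%:E.
  apply/eqP; rewrite eq_le; apply/andP; split.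
    apply: ereal_inf_lbound; exists (i0, j0) => //=.
    by rewrite vu ve -!EFinM mulr1 -EFinD.
  apply: le_ereal_inf_tmp => _ [[i j]/= Fij <-].
  by rewrite vu ve -!EFinM mulr1 -EFinD lee_fin hmin.
have [s hs] := veqP hv f0.
rewrite tE hs /=.
have hmon i j : (t%:E <= v ((F i j : nat)%:R * u ^+ i * eta ^+ j)%R)%E.
  have [->|Fij] := eqVneq (F i j) 0; first by rewrite mulr0n !mul0r (vge0 hv).
  rewrite (veqM hv (veqM hv (vflat_Fp C p_gt2 Fij) (veqX hv i vu)) (veqX hv j ve)).
  by rewrite add0r mulr1 lee_fin hmin.
split.
  rewrite -hs; apply: (vge_lim hv hF) => M.
  by apply: (vge_sum hv) => i _; apply: (vge_sum hv) => j _.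
have [M hM] := hF s.
(* Large enough for the partial sum to contain the monomial [(i0, j0)] and to be within valuation
   [s] of [f]. *)
pose M' := maxn M (maxn i0 j0).
have i0M : (i0 <= M')%N by rewrite !leq_max leqnn !orbT.
have j0M : (j0 <= M')%N by rewrite !leq_max leqnn !orbT.
have hp : (s%:E <= v (partial_sum u eta F M'))%E.
  apply: (@vge_congr _ _ _ hv f _ s s) => //; first by rewrite hs.
  by rewrite (valB hv); apply: hM; rewrite leq_max leqnn.
have le := partial_sum_bound p_gt2 u_sharp eps_prim hp i0M j0M F0 hmin hlt.
rewrite lte_fin; apply: le_lt_trans le _; apply: bound_lt_frakM => //.
by rewrite lerDl mulr_ge0// ltW.
Qed.

End FirstPart.

(** * The Gamma function *)

Section GammaFunction.
Variable R : realType.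
Local Notation mu := (@lebesgue_measure R).
Implicit Types (a s x : R).

Definition pexp a x : R := x `^ a * expR (- x).
Definition hexp x : R := expR (- (x / 2)).

Lemma pexp_ge0 a x : 0 <= pexp a x.
Proof. by rewrite mulr_ge0 ?powR_ge0 ?expR_ge0. Qed.

(** For a positive integer [m >= a], [x^a <= (1 + x)^m <= (2m)^m (1 + x/(2m))^m], and the last power
    is at most [exp(x/2)]. *)
Lemma pexp_le_hexp a : 0 <= a ->
  exists2 c, 0 < c & forall x, 0 <= x -> pexp a x <= c * hexp x.
Proof.
move=> a0; have [m0 hm0] := Defs.nat_gt a; pose m := m0.+1.
have am : a <= m%:R by apply: le_trans (ltW hm0) _; rewrite ler_nat.
have m2 : 0 < 2 * m%:R :> R by rewrite mulr_gt0.
exists ((2 * m%:R) ^+ m); first exact: exprn_gt0.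
move=> x x0.
have h1 : x `^ a <= (1 + x) ^+ m.
  apply: (@le_trans _ _ ((1 + x) `^ a)).
    by apply: ge0_ler_powR; rewrite ?nnegrE//; lra.
  rewrite -powR_mulrn; last lra.
  by apply: ler_powR => //; lra.
have h2 : (1 + x) ^+ m <= (2 * m%:R) ^+ m * expR (x / 2).
  have -> : x / 2 = m%:R * (x / (2 * m%:R)) by field; rewrite pnatr_eq0.
  rewrite expRM_natl -exprMn ler_pXn2r// ?nnegrE ?mulr_ge0 ?expR_ge0//; [|lra].
  apply: (@le_trans _ _ (2 * m%:R * (1 + x / (2 * m%:R)))).
    rewrite mulrDr mulr1 mulrCA divff ?gt_eqF// mulr1 lerD2r.
    by have : 1 <= m%:R :> R; [rewrite ler1n|lra].
  by rewrite ler_pM2l// expR_ge1Dx.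
rewrite /pexp /hexp; have -> : - (x / 2) = x / 2 + - x by lra.
by rewrite expRD mulrA ler_wpM2r ?expR_ge0// (le_trans h1).
Qed.

Lemma hexp_cvg0 : hexp x @[x --> +oo] --> 0.
Proof.
apply: (@cvg_comp _ _ _ (fun x : R => x / 2) (fun x : R => expR (- x)) _ (pinfty_nbhs R)); last exact: cvgr_expR.
by apply: gt0_cvgMly; rewrite ?invr_gt0//; exact: cvg_id.
Qed.

Lemma pexp_cvg0 a : 0 <= a -> pexp a x @[x --> +oo] --> 0.
Proof.
move=> a0; have [c c0 hc] := pexp_le_hexp a0.
have cc : c * hexp x @[x --> +oo] --> 0.
  by rewrite -[X in _ --> X](mulr0 c); apply: cvgMr; exact: hexp_cvg0.
apply: squeeze_cvgr (cvg_cst 0) cc.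
near=> x; rewrite pexp_ge0 hc//; near: x; exact: nbhs_pinfty_ge.
Unshelve. all: by end_near. Qed.

Lemma is_derive_pexp a x : 0 < x ->
  is_derive x 1 (pexp a) (a * pexp (a - 1) x - pexp a x).
Proof.
move=> x0; rewrite /pexp.
have h1 := is_derive1_powR a x0.
have h2 : is_derive x 1 (fun x : R => expR (- x)) (- expR (- x)).
  by apply: is_derive_eq; rewrite /GRing.scale/=; ring.
apply: is_derive_eq; rewrite /GRing.scale/=; ring.
Qed.

Lemma is_derive_hexp x : is_derive x 1 hexp (- (hexp x / 2)).
Proof.
by rewrite /hexp; apply: is_derive_eq; rewrite /GRing.scale/=; ring.
Qed.

Lemma continuous_hexp : continuous hexp.
Proof.
move=> x; apply: differentiable_continuous; apply/derivable1_diffP.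
by have [] := is_derive_hexp x.
Qed.

Lemma within_continuous_pexp a : 0 < a -> {within `[0, +oo[, continuous (pexp a)}.
Proof.
move=> a0; apply/continuous_within_itvcyP; split.
  move=> x; rewrite in_itv/= andbT => x0.
  apply: differentiable_continuous; apply/derivable1_diffP.
  by have [] := is_derive_pexp a x0.
rewrite {2}/pexp powR0 ?gt_eqF// -[X in _ --> X](_ : 0 * expR (- 0) = _)//.
apply: cvgM; first exact: powR_cvg0.
by apply/cvg_at_right_filter; apply: continuous_comp; [exact: opp_continuous|exact: continuous_expR].
Qed.

Lemma measurable_pexp a : 0 < a -> measurable_fun (`[(0 : R), +oo[)%classic (fun x => (pexp a x)%:E).
Proof.
move=> a0; apply/measurable_EFinP.
by apply: subspace_continuous_measurable_fun => //; exact: within_continuous_pexp.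
Qed.

Lemma integral_hexp k : 0 <= k ->
  (\int[mu]_(x in `[0%R, +oo[) ((k / 2 * hexp x)%R)%:E = k%:E)%E.
Proof.
move=> k0; rewrite (@ge0_continuous_FTC2y _ _ (fun x => - k * hexp x) _ 0).
- by rewrite /hexp mul0r oppr0 expR0 mulr1 sub0e -EFinN opprK.
- by move=> x _; rewrite !mulr_ge0// /hexp expR_ge0.
- by apply: continuous_subspaceT => x; apply: cvgMr; exact: continuous_hexp.
- by rewrite -[X in _ --> X](mulr0 (- k)); apply: cvgMr; exact: hexp_cvg0.
- by move=> x _; apply: ex_derive.
- by apply: cvgMr; apply/cvg_at_right_filter; exact: continuous_hexp.
- move=> x _; have h := is_derive_hexp x; rewrite derive1E derive_val /GRing.scale/=; ring.
Qed.

(** Integration by parts, with a multiple of [hexp] added so that only nonnegative functions are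
    integrated. The added function has the finite integral [k], which cancels in the end and also
    bounds the integral of [(s + 1) * pexp s]. *)
Lemma integral_pexp_rec s : 0 < s ->
  (\int[mu]_(x in `[0%R, +oo[) (pexp (s + 1) x)%:E =
   (s + 1)%:E * \int[mu]_(x in `[0%R, +oo[) (pexp s x)%:E /\
   \int[mu]_(x in `[0%R, +oo[) (pexp s x)%:E < +oo)%E.
Proof.
move=> s0; have [c c0 hc] := pexp_le_hexp (ltW s0).
have s1 : 0 < s + 1 by lra.
pose k := 2 * ((s + 1) * c).
have k0 : 0 <= k by rewrite !mulr_ge0// ltW.
have kh x : 0 <= x -> (s + 1) * pexp s x <= k / 2 * hexp x.
  move=> x0; have -> : k / 2 = (s + 1) * c by rewrite /k; field.
  by rewrite -mulrA ler_pM2l// hc.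
pose D := [set` `[(0 : R), +oo[].
have mD : measurable D by exact: measurable_itv.
have D0 x : D x -> 0 <= x by rewrite /D /= in_itv/= andbT.
have mh : measurable_fun D (fun x => (k / 2 * hexp x)%:E).
  apply/measurable_EFinP; apply: subspace_continuous_measurable_fun => //.
  by apply: continuous_subspaceT => x; apply: cvgMr; exact: continuous_hexp.
(* The derivative of [- pexp (s + 1) - k * hexp], nonnegative by the choice of [k]. *)
pose f x := pexp (s + 1) x - (s + 1) * pexp s x + k / 2 * hexp x.
have f0 x : 0 <= x -> 0 <= f x.
  by move=> x0; have := kh x x0; have := pexp_ge0 (s + 1) x; rewrite /f; lra.
have cf : {within `[0, +oo[, continuous f}.
  have /continuous_within_itvcyP[c1 l1] := within_continuous_pexp s1.
  have /continuous_within_itvcyP[c2 l2] := within_continuous_pexp s0.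
  apply/continuous_within_itvcyP; split.
    move=> x x0; apply: cvgD.
      apply: cvgB; first exact: c1.
      by apply: cvgMr; exact: c2.
    by apply: cvgMr; exact: continuous_hexp.
  apply: cvgD.
    by apply: cvgB => //; apply: cvgMr.
  by apply: cvgMr; apply/cvg_at_right_filter; exact: continuous_hexp.
have If : (\int[mu]_(x in D) (f x)%:E = k%:E)%E.
  rewrite (@ge0_continuous_FTC2y _ _ (fun x => - pexp (s + 1) x + - k * hexp x) _ 0).
  - have -> : - pexp (s + 1) 0 + - k * hexp 0 = - k.
      by rewrite /hexp /pexp powR0 ?gt_eqF// !mul0r !oppr0 expR0 mulr1 add0r.
    by rewrite sub0e -EFinN opprK.
  - exact: f0.
  - exact: cf.
  - rewrite -[X in _ --> X](_ : - 0 + - k * 0 = _); last by rewrite oppr0 mulr0 addr0.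
    apply: cvgD; first by apply: cvgN; apply: pexp_cvg0; lra.
    by apply: cvgMr; exact: hexp_cvg0.
  - move=> x x0; have h1 := is_derive_pexp (s + 1) x0; exact: ex_derive.
  - apply: cvgD.
      apply: cvgN.
      by have /continuous_within_itvcyP[_] := within_continuous_pexp s1.
    by apply: cvgMr; apply/cvg_at_right_filter; exact: continuous_hexp.
  - move=> x; rewrite in_itv/= andbT => x0.
    have h1 := is_derive_pexp (s + 1) x0; have h2 := is_derive_hexp x.
    by rewrite derive1E derive_val /GRing.scale/= /f addrK; ring.
have Ih := integral_hexp k0; rewrite -/D in Ih.
have mf : measurable_fun D (fun x => (f x)%:E).
  by apply/measurable_EFinP; apply: subspace_continuous_measurable_fun.
have mp a : 0 < a -> measurable_fun D (fun x => (pexp a x)%:E) by exact: measurable_pexp.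
have Is : (\int[mu]_(x in D) ((s + 1) * pexp s x)%:E = (s + 1)%:E * \int[mu]_(x in D) (pexp s x)%:E)%E.
  under eq_integral => x _ do rewrite EFinM.
  rewrite ge0_integralZl//; first exact: mp.
    by move=> x _; rewrite lee_fin pexp_ge0.
  by rewrite lee_fin ltW.
have ms : measurable_fun D (fun x => ((s + 1) * pexp s x)%:E).
  under eq_fun do rewrite EFinM; exact: measurable_funeM (mp _ s0).
split.
  have e1 := @ge0_integralD _ _ R mu D mD (fun x => (pexp (s + 1) x)%:E)
    (fun x => (k / 2 * hexp x)%:E).
  have e2 := @ge0_integralD _ _ R mu D mD (fun x => (f x)%:E)
    (fun x => ((s + 1) * pexp s x)%:E).
  rewrite /= in e1 e2.
  have : (\int[mu]_(x in D) (pexp (s + 1) x)%:E + k%:E =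
          k%:E + (s + 1)%:E * \int[mu]_(x in D) (pexp s x)%:E)%E.
    rewrite -Is -[X in (_ + X = _)%E]Ih -[X in (_ = X + _)%E]If.
    rewrite -e1//; [rewrite -e2//| |exact: mp|].
    + by apply: eq_integral => x _; rewrite -!EFinD; congr EFin; rewrite /f; ring.
    + by move=> x /D0 x0; rewrite lee_fin f0.
    + by move=> x _; rewrite lee_fin mulr_ge0 ?pexp_ge0// ltW.
    + by move=> x _; rewrite lee_fin pexp_ge0.
    + by move=> x _; rewrite lee_fin mulr_ge0 ?expR_ge0// divr_ge0.
  move=> /(congr1 (fun y => y - k%:E)%E).
  by rewrite addeK// [X in _ = (X - _)%E]addeC addeK.
have : ((s + 1)%:E * \int[mu]_(x in D) (pexp s x)%:E < +oo)%E.
  rewrite -Is; apply: (@le_lt_trans _ _ k%:E); last exact: ltry.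
  rewrite -Ih; apply: ge0_le_integral => //.
  - by move=> x _; rewrite lee_fin mulr_ge0 ?pexp_ge0// ltW.
  - by move=> x /D0 x0; rewrite lee_fin kh.
apply: contraTT; rewrite -leNgt leye_eq => /eqP ->.
by rewrite gt0_muley ?lte_fin// ltxx.
Qed.

Lemma integral_pexp_ge a : 0 < a ->
  ((expR (- 2))%:E <= \int[mu]_(x in `[0%R, +oo[) (pexp a x)%:E)%E.
Proof.
move=> a0; apply: (@le_trans _ _ (\int[mu]_(x in `[1%R, 2%R]) (pexp a x)%:E)%E); last first.
  apply: ge0_subset_integral => //; first exact: measurable_pexp.
    by move=> x _; rewrite lee_fin pexp_ge0.
  by move=> x /=; rewrite !in_itv/= andbT => /andP[x1 _]; lra.
have -> : (expR (- 2))%:E = (\int[mu]_(x in `[1%R, 2%R]) (cst (expR (- 2))%:E) x)%E.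
  rewrite integral_cst; last exact: measurable_itv.
  rewrite [X in (_ * X)%E](_ : _ = 1%:E); last first.
    apply: etrans (lebesgue_measure_itv `[(1 : R), 2]) _; rewrite /= lte_fin ltr1n/= -EFinB.
    by congr EFin; lra.
  by rewrite mule1.
apply: ge0_le_integral => //.
- by move=> x _; rewrite lee_fin expR_ge0.
- apply: measurable_funS (measurable_pexp a0) => //.
  by move=> x /=; rewrite !in_itv/= andbT => /andP[x1 _]; lra.
move=> x /=; rewrite in_itv/= => /andP[x1 x2]; rewrite lee_fin /pexp -[leLHS]mul1r.
apply: ler_pM; rewrite ?expR_ge0// ?ler_expR ?lerN2//.
by rewrite -(powRr0 x); apply: ler_powR => //; exact: ltW.
Qed.

(** The endpoint 0 does not change the integral; for [s > 1] the integrand is continuous on the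
    closed half-line. *)
Lemma GammaE s : 1 < s -> Gamma s = fine (\int[mu]_(x in `[0%R, +oo[) (pexp (s - 1) x)%:E)%E.
Proof.
move=> s1; rewrite /Gamma /Rintegral; congr fine.
rewrite integral_itv_obnd_cbnd//.
apply: measurable_funS (measurable_pexp _) => //; last lra.
by move=> x /=; rewrite !in_itv/= !andbT; exact: ltW.
Qed.

Lemma Gamma_rec s : 1 < s -> Gamma (s + 1) = s * Gamma s.
Proof.
move=> s1; have s0 : 0 < s - 1 by lra.
rewrite !GammaE//; last lra.
have [e _] := integral_pexp_rec s0; rewrite addrK -{1}(subrK 1 s) e subrK.
by rewrite fineM// ge0_fin_numE ?integral_ge0// => [|x _]; rewrite ?lee_fin ?pexp_ge0//; have [] := integral_pexp_rec s0.
Qed.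

Lemma Gamma_ge s : 1 < s -> expR (- 2) <= Gamma s.
Proof.
move=> s1; have s0 : 0 < s - 1 by lra.
rewrite GammaE// -lee_fin fineK ?integral_pexp_ge//.
by rewrite ge0_fin_numE ?integral_ge0// => [|x _]; rewrite ?lee_fin ?pexp_ge0//; have [] := integral_pexp_rec s0.
Qed.

(** Induction with [Gamma_rec], comparing the factors [k + b] and [k + c]. The constant bounds
    [Gamma c] from below uniformly in [c], which matters because [c] will depend on [t]. *)
Lemma Gamma_prod_le (b c : R) m : 1 < b -> b <= c ->
  expR (- 2) * \prod_(0 <= k < m) (k%:R + b) <= Gamma (c + m%:R).
Proof.
move=> b1 bc; elim: m => [|m ih].
  by rewrite big_geq// mulr1 addr0; apply: Gamma_ge; lra.
have m0 := ler0n R m.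
rewrite big_nat_recr//= mulrA.
have -> : c + m.+1%:R = c + m%:R + 1 by rewrite -natr1 addrA.
rewrite Gamma_rec; last lra.
rewrite mulrC; apply: ler_pM => //; [lra| |lra].
rewrite mulr_ge0 ?expR_ge0// prodr_ge0// => k _; have := ler0n R k; lra.
Qed.

End GammaFunction.

(** * Growth of M *)

Lemma frakQ_ratr (R : realType) (p m : nat) : ratr (frakQ p rat m) = frakQ p R m.
Proof.
rewrite /frakQ rmorphM rmorphXn/= ratr_nat rmorph_prod/=; congr (_ * _).
apply: eq_bigr => k _; rewrite rmorphD fmorph_div rmorphD/= !ratr_nat rmorph1.
by [].
Qed.

Lemma frakQ_ge0 (R : realType) (p m : nat) : 0 <= frakQ p R m.
Proof.
by rewrite mulr_ge0 ?exprn_ge0// prodr_ge0.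
Qed.

Lemma frakQ_le_Gamma (R : realType) (p : nat) (t : R) : (2 < p)%N -> 0 < t ->
  frakQ p R (`|Num.ceil t|%N.+1) <=
  p%:R ^+ 2 * expR 2 * (p%:R `^ t * Gamma (t + (3 + p%:R^-1))).
Proof.
move=> p_gt2 t0; set n := `|_|%N.
have P3 : 3 <= p%:R :> R by rewrite (ler_nat _ 3).
have nt : n%:R < t + 1.
  have c0 : 0 <= Num.ceil t by rewrite -(ceil0 R) ceil_le// ltW.
  have -> : n%:R = (Num.ceil t)%:~R :> R by rewrite /n -[in RHS](gez0_abs c0).
  by have := gt_pred_ceil t; rewrite rmorphB/= ltrBlDr.
have pV : (p%:R + 1) / p%:R = 1 + p%:R^-1 :> R by rewrite mulrDl divff ?mul1r// gt_eqF; lra.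
have pV0 : 0 < p%:R^-1 :> R by rewrite invr_gt0; lra.
have b1 : 1 < (p%:R + 1) / p%:R :> R by rewrite pV; lra.
(* Chosen so that [c + n.+1] is [t + (3 + 1/p)]; then [n < t + 1] gives [c >= 1 + 1/p]. *)
pose c := t - n%:R + 2 + p%:R^-1.
have bc : (p%:R + 1) / p%:R <= c by rewrite pV /c; lra.
have := Gamma_prod_le n.+1 b1 bc.
have -> : c + n.+1%:R = t + (3 + p%:R^-1) by rewrite /c -natr1; ring.
set G := Gamma _; set A := \prod_(_ <= _ < _) _ => hA.
have {}hA : A <= expR 2 * G.
  by move: hA; rewrite expRN mulrC ler_pdivrMr ?expR_gt0// mulrC.
have pn : p%:R ^+ n.+1 <= p%:R ^+ 2 * p%:R `^ t :> R.
  rewrite -!powR_mulrn ?ler0n// -powRD; last by rewrite gt_eqF ?implybT//; lra.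
  by apply: ler_powR; [lra|rewrite -natr1; lra].
rewrite /frakQ -/A [leRHS](_ : _ = (p%:R ^+ 2 * p%:R `^ t) * (expR 2 * G)); last by ring.
apply: ler_pM => //.
by rewrite prodr_ge0// => k _; rewrite addr_ge0//; lra.
Qed.

Lemma frakM_bigO (R : realType) (p : nat) : (2 < p)%N ->
  (fun t : R => ratr (frakM p t) : R) =O_ (FilterType (pinfty_nbhs R) _)
    (fun t : R => (p%:R : R) `^ (2 * t) * Gamma (t + (3 + p%:R^-1)) ^+ 2).
Proof.
move=> p_gt2; apply/eqO_exP.
have P3 : 3 <= p%:R :> R by rewrite (ler_nat _ 3).
have e0 : 0 < p%:R / (p%:R - 1) :> R by apply: divr_gt0; lra.
exists (p%:R / (p%:R - 1) * (p%:R ^+ 2 * expR 2) ^+ 2).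
  by rewrite mulr_gt0// exprn_gt0// mulr_gt0 ?expR_gt0// exprn_gt0//; lra.
near=> t.
have t0 : 0 < t by near: t; exact: nbhs_pinfty_gt.
have /andP[_ hM] := frakM_bounds p_gt2 t.
have hQ := frakQ_le_Gamma p_gt2 t0.
have M0 : 0 < ratr (frakM p t) :> R by rewrite ltr0q frakM_gt0//; lia.
move: (frakM p t) hM M0 => M hM M0.
rewrite (gtr0_norm M0) ger0_norm; last by apply: mulr_ge0; [exact: powR_ge0|exact: sqr_ge0].
apply: (@le_trans _ _ (p%:R / (p%:R - 1) * frakQ p R (`|Num.ceil t|%N.+1) ^+ 2)).
  move: hM; rewrite -(ler_rat R) rmorphM fmorph_div rmorphB rmorphXn/= !ratr_nat ?rmorph1.
  by rewrite frakQ_ratr.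
rewrite -[leRHS]mulrA ler_pM2l//.
have -> : p%:R `^ (2 * t) = (p%:R `^ t) ^+ 2 :> R.
  by rewrite mulrC powRrM -powR_mulrn ?powR_ge0.
have Q0 := frakQ_ge0 R p (`|Num.ceil t|%N.+1).
by rewrite -!exprMn ler_pXn2r ?nnegrE// (le_trans Q0).
Unshelve. all: by end_near. Qed.

Theorem theoremA1 (R : realType) (p : nat) (p_prime : prime p) (p_ge3 : (3 <= p)%N)
    (C : CpField R p) (u eps : tilt C)
    (u_sharp : sharp u = p%:R)
    (eps_prim : forall n : nat, (p ^ n).-primitive_root (eps n)) :
  let eta : tilt C := eps - 1 in
  (forall f : tilt C, Enp_plus u eta f -> f != 0 ->
     ((ratr (frakM p (0 : R)))%:E <= vflat f)%E ->
     (vmono u eta f <= vflat f)%E /\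
     (vflat f < (ratr (frakM p (fine (vmono u eta f))))%:E)%E) /\
  (fun t : R => ratr (frakM p t) : R) =O_ (FilterType (pinfty_nbhs R) _)
    (fun t : R => (p%:R : R) `^ (2 * t) * Gamma (t + (3 + p%:R^-1)) ^+ 2).
Proof.
move=> eta; split; last exact: frakM_bigO.
by move=> f hf f0 _; apply: vflat_bounds.
Qed.
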